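(* Consider the following six polynomials in $\mathbb{C}[x,y,z,t]$: \begin{align*} f_1&=4x-z, & f_2&=4y-z,\\ f_3&=4x^2y-z(y-t)^2, & f_4&=4xy^2-z(x-t)^2,\\ f_5&=(x-y)^2-2(x+y)t+t^2, & f_6&=(x-y)^2-2(x+y)(z+t)+(z+t)^2. \end{align*} Then the square root $\sqrt{f_1f_2f_3f_4}$ is not rationalizable, and hence the set $\mathcal{A}=\{f_1,f_2,f_3,f_4,f_5,f_6\}$ is not rationalizable either.
   Context: Let $f\in\mathbb{C}[x_1,\dots,x_n]$ be a squarefree polynomial. The square root $\sqrt f$ is called rationalizable if there is a morphism of fields $\phi\colon\mathbb{C}(x_1,\dots,x_n)\to\mathbb{C}(x_1,\dots,x_n)$ such that $\phi(c)=c$ for every $c\in\mathbb{C}$ and $\phi(f)=h^2$ for some $h\in\mathbb{C}(x_1,\dots,x_n)$. A set $\{f_1,\dots,f_r\}$ of squarefree polynomials in $\mathbb{C}[x_1,\dots,x_n]$ (representing the set of their square roots) is called rationalizable if there is a single morphism of fields $\phi\colon\mathbb{C}(x_1,\dots,x_n)\to\mathbb{C}(x_1,\dots,x_n)$ with $\phi(c)=c$ for every $c\in\mathbb{C}$ such that for every $i=1,\dots,r$ one has $\phi(f_i)=h_i^2$ for some $h_i\in\mathbb{C}(x_1,\dots,x_n)$. Here $n=4$ and the variables are $x,y,z,t$. *)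

(* Defs.v *)
From HB Require Import structures.
From mathcomp Require Import all_boot all_order all_algebra.
From mathcomp Require Import fraction reals.
From mathcomp.real_closed Require Import complex.
From mathcomp Require Import mpoly.

Set Implicit Arguments.
Unset Strict Implicit.
Unset Printing Implicit Defensive.

Import GRing.Theory.
Local Open Scope ring_scope.

Notation ratfun K n := {fraction {mpoly K[n]}}.

Definition fixes_constants (K : fieldType) (n : nat)
    (phi : ratfun K n -> ratfun K n) : Prop :=
  forall c : K, phi (tofrac c%:MP) = tofrac c%:MP.

(* Usually reserved for squarefree f, but meaningful for every f; squarefreeness
   is not made part of the predicate, so that its negation only says that no
   suitable phi exists. *)
Definition rationalizable (K : fieldType) (n : nat) (f : {mpoly K[n]}) : Prop :=
  exists2 phi : {rmorphism ratfun K n -> ratfun K n},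
    fixes_constants phi &
    exists h : ratfun K n, phi (tofrac f) = h ^+ 2.

Definition rationalizable_set (K : fieldType) (n : nat)
    (A : seq {mpoly K[n]}) : Prop :=
  exists2 phi : {rmorphism ratfun K n -> ratfun K n},
    fixes_constants phi &
    forall f, f \in A -> exists h : ratfun K n, phi (tofrac f) = h ^+ 2.

Section Polynomials.
Variable K : fieldType.

Let x : {mpoly K[4]} := 'X_(@Ordinal 4 0 isT).
Let y : {mpoly K[4]} := 'X_(@Ordinal 4 1 isT).
Let z : {mpoly K[4]} := 'X_(@Ordinal 4 2 isT).
Let t : {mpoly K[4]} := 'X_(@Ordinal 4 3 isT).

Definition f1 : {mpoly K[4]} := 4 * x - z.
Definition f2 : {mpoly K[4]} := 4 * y - z.
Definition f3 : {mpoly K[4]} := 4 * x ^+ 2 * y - z * (y - t) ^+ 2.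
Definition f4 : {mpoly K[4]} := 4 * x * y ^+ 2 - z * (x - t) ^+ 2.
Definition f5 : {mpoly K[4]} := (x - y) ^+ 2 - 2 * (x + y) * t + t ^+ 2.
Definition f6 : {mpoly K[4]} :=
  (x - y) ^+ 2 - 2 * (x + y) * (z + t) + (z + t) ^+ 2.

End Polynomials.

(* Main.v *)
(* The substitution p = z/x, q = z/y, u = zt/(xy) turns the double cover
   w^2 = f1 f2 f3 f4 into w^2 = S with
     S = p q (p-4) (q-4) (4q - (p-u)^2) (4p - (q-u)^2),
   a singular Calabi-Yau threefold on which the 3-form dp dq du / w is regular.
   A field morphism rationalizing S would pull it back to a regular 3-form on a
   projective space, which must be zero, although the pullback is dominant.
   - Regularity (the pair (P^3, S/2) is klt): for every discrete valuation v and
     logarithmic derivations, the Jacobian J of (p, q, u) satisfies v(S) < 2 v(J).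
   - Vanishing: on the line through the generic point s in a coordinate direction,
     p, q, u, w become functions in K(t) with K = C(s), and J/w has no pole at any
     place of K(t) and a zero at infinity, so J = 0.
   - Dominance: if all the 3x3 Jacobians of (p, q, u) vanish, some nonzero derivation
     kills x, y, z, t.  In characteristic 0 it then kills everything algebraic over
     C(x, y, z, t), and by counting monomials this is the whole field. *)
Require Import Defs.
From HB Require Import structures.
From mathcomp Require Import all_boot all_order all_algebra.
From mathcomp Require Import fraction reals.
From mathcomp.real_closed Require Import complex.
From mathcomp Require Import mpoly.
From mathcomp Require Import qpoly zify ring.

Set Implicit Arguments.
Unset Strict Implicit.
Unset Printing Implicit Defensive.

Import Order.TTheory GRing.Theory Num.Theory.
Local Open Scope ring_scope.

Local Notation "x %:F" := (tofrac x).

(** * Derivations and Jacobians *)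

Definition derivation (R : comNzRingType) (d : R -> R) : Prop :=
  {morph d : a b / a + b} /\ forall a b, d (a * b) = d a * b + a * d b.

Section Derivation.
Variables (R : comNzRingType) (d : R -> R).
Hypothesis dP : derivation d.

Lemma derivationD a b : d (a + b) = d a + d b. Proof. exact: dP.1. Qed.
Lemma derivationM a b : d (a * b) = d a * b + a * d b. Proof. exact: dP.2. Qed.

Lemma derivation0 : d 0 = 0.
Proof. by apply: (addIr (d 0)); rewrite -derivationD !add0r. Qed.

Lemma derivationN a : d (- a) = - d a.
Proof. by apply: (addrI (d a)); rewrite -derivationD !subrr derivation0. Qed.

Lemma derivationB a b : d (a - b) = d a - d b.
Proof. by rewrite derivationD derivationN. Qed.

Lemma derivation_nat n : d n%:R = 0.
Proof.
have d1 : d 1 = 0.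
  by apply: (addIr (d 1)); rewrite add0r -{3}(mulr1 1) derivationM mulr1 mul1r.
elim: n => [|n IHn]; first exact: derivation0.
by rewrite -addn1 natrD derivationD IHn d1 addr0.
Qed.

Lemma derivation_sqr a : d (a ^+ 2) = 2 * a * d a.
Proof. by rewrite expr2 derivationM; ring. Qed.

Lemma derivation_sum (I : Type) (r : seq I) (P : pred I) F :
  d (\sum_(i <- r | P i) F i) = \sum_(i <- r | P i) d (F i).
Proof. exact: (big_morph _ derivationD derivation0). Qed.

End Derivation.

Definition jacobian (R : comNzRingType) (d1 d2 d3 : R -> R) (a b c : R) : R :=
  d1 a * (d2 b * d3 c - d3 b * d2 c)
  - d2 a * (d1 b * d3 c - d3 b * d1 c)
  + d3 a * (d1 b * d2 c - d2 b * d1 c).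

(* With p = z/x, q = z/y and u = zt/(xy), this is f1 f2 f3 f4 up to a square:
   f1 = x (4 - p), f2 = y (4 - q), f3 = x^2 y (4 q - (p - u)^2) / q and
   f4 = x y^2 (4 p - (q - u)^2) / p. *)
Definition branch (R : comNzRingType) (p q u : R) : R :=
  p * q * (p - 4) * (q - 4) * (4 * q - (p - u) ^+ 2) * (4 * p - (q - u) ^+ 2).

(** * The local estimate *)

(* In the next three lemmas p, q, p4, q4, p1, m, n, g, h, m2, n2 and j stand for the
   valuations of p, q, p - 4, q - 4, p - 1, m = p - u, n = q - u, g = 4 q - m^2,
   h = 4 p - n^2, m + 2, n + 2 and of the Jacobian of (p, q, u). *)
Lemma residual_bound_arith (b m g q j : int) :
    b + m <= j -> b + g <= m + j ->
    (g <= q \/ 2 * m <= q) /\ (q <= g \/ 2 * m <= g) /\ (g <= 2 * m \/ q <= 2 * m) ->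
  2 * b + 2 * g - q <= 2 * j.
(* The sum of the first two bounds, [2 b + g <= 2 j], suffices if [g <= q]. Otherwise the minimum
   among [g], [q], [2 m] is attained twice, so [2 m = q], and the second bound doubled suffices. *)
Proof. lia. Qed.

Lemma special_base_arith (p q p4 q4 g h j : int) :
    (p4 <= p \/ 0 <= p) /\ (p <= p4 \/ 0 <= p4) /\ (p4 <= 0 \/ p <= 0) ->
    (q4 <= q \/ 0 <= q) /\ (q <= q4 \/ 0 <= q4) /\ (q4 <= 0 \/ q <= 0) ->
    (forall b, b \in [:: p + q; p4 + q; p + q4; p4 + q4] ->
       2 * b + 2 * g - q <= 2 * j /\ 2 * b + 2 * h - p <= 2 * j) ->
    ~~ [&& p == 0, q == 0, p4 == 0 & q4 == 0] ->
  p + q + p4 + q4 + g + h < 2 * j.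
Proof.
move=> Up Uq H.
have [] := H (p + q); first by rewrite !inE eqxx ?orbT.
have [] := H (p4 + q); first by rewrite !inE eqxx ?orbT.
have [] := H (p + q4); first by rewrite !inE eqxx ?orbT.
have [] := H (p4 + q4); first by rewrite !inE eqxx ?orbT.
(* The bounds for [g] and [h] are averaged at the base [b] that picks from each of the pairs [p],
   [p4] and [q], [q4] a nonzero valuation if there is one. A pole, a zero, or the value 4 each
   leaves a strict gain. *)
by move: Up Uq; clear; lia.
Qed.

Lemma generic_base_arith (p1 m n g h m2 n2 j : int) :
    (g <= 0 \/ 2 * m <= 0) /\ (0 <= g \/ 2 * m <= g) /\ (g <= 2 * m \/ 0 <= 2 * m) ->
    (h <= 0 \/ 2 * n <= 0) /\ (0 <= h \/ 2 * n <= h) /\ (h <= 2 * n \/ 0 <= 2 * n) ->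
    (0 < h -> 0 < n2 -> 0 < p1) ->
    m <= j -> n <= j -> (0 <= m -> 1 <= j) -> g <= m + j -> h <= n + j ->
    p1 + g <= m + j -> p1 + h <= n + j ->
    g + h <= n + m2 + j -> g + h <= m + n2 + j ->
  g + h < 2 * j.
(* In the only tight case [g] and [h] are positive, so [m = n = 0] and [g, h <= j]. Equality would
   make [m2] and [n2] positive: the valuation is then centred at the point [p = q = 1], [u = 3],
   where the surfaces [g = 0] and [h = 0] are tangent. There [p1 > 0], and the bounds involving [p1]
   exclude equality. *)
Proof. lia. Qed.

(* The d_i are logarithmic derivations for v.  The Jacobian of three nonzero functions
   then has valuation at least the sum of their valuations; the estimate compares
   several triples (p - a, q - b, m), (p - a, q - b, g), (p, g, h), etc., whose
   Jacobians are explicit multiples of that of (p, q, u). *)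
Section LogDiscrepancy.
Variables (E : fieldType) (v : E -> int).
Hypothesis vM : forall x y : E, x != 0 -> y != 0 -> v (x * y) = v x + v y.
Hypothesis vD : forall (x y : E) (k : int), x != 0 -> y != 0 -> x + y != 0 ->
  k <= v x -> k <= v y -> k <= v (x + y).
Hypothesis v_nat : forall n, n.+1%:R != 0 :> E /\ v n.+1%:R = 0.
Variables d1 d2 d3 : E -> E.
Hypotheses (d1P : derivation d1) (d2P : derivation d2) (d3P : derivation d3).
Hypothesis v_d1 : forall x : E, x != 0 -> d1 x != 0 -> v x <= v (d1 x).
Hypothesis v_d2 : forall x : E, x != 0 -> d2 x != 0 -> v x <= v (d2 x).
Hypothesis v_d3 : forall x : E, x != 0 -> d3 x != 0 -> v x <= v (d3 x).
Hypothesis v_d1_gt0 : forall x : E, x != 0 -> d1 x != 0 -> 0 <= v x -> 1 <= v (d1 x).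

Let ge (k : int) (x : E) := (x == 0) || (k <= v x).
Local Notation J := (jacobian d1 d2 d3).

Let v1 : v (1 : E) = 0. Proof. by case: (v_nat 0). Qed.

Let valN (x : E) : v (- x) = v x.
Proof.
have [->|x0] := eqVneq x 0; first by rewrite oppr0.
have N1 : v (-1) = 0.
  have : v (-1 * -1) = 0 by rewrite mulrNN mulr1 v1.
  by rewrite vM ?oppr_eq0 ?oner_eq0 //; lia.
by rewrite -mulN1r vM ?oppr_eq0 ?oner_eq0 // N1 add0r.
Qed.

Let geD k (x y : E) : ge k x -> ge k y -> ge k (x + y).
Proof.
rewrite /ge; have [->|x0] := eqVneq x 0; first by rewrite add0r.
have [->|y0] /= := eqVneq y 0; first by rewrite addr0 (negPf x0).
by have [|s0] := eqVneq (x + y) 0 => //=; apply: vD.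
Qed.

Let geN k x : ge k x -> ge k (- x).
Proof. by rewrite /ge oppr_eq0 valN. Qed.

Let geM k l x y : ge k x -> ge l y -> ge (k + l) (x * y).
Proof.
rewrite /ge mulf_eq0; have [|x0] := eqVneq x 0 => //=.
have [|y0] := eqVneq y 0 => //=; rewrite vM //; lia.
Qed.

(** The weights [k_i] for [d1] and [l_i] for [d2], [d3] differ by the same amount for all three
    functions, so every term of the determinant has the same lower bound. Logarithmic bounds use
    [k_i = l_i]; the bound 1 for integral functions uses [k_i = 1], [l_i = 0]. *)
Let jacobian_ge k1 k2 k3 l1 l2 l3 x y z :
  ge k1 (d1 x) -> ge k2 (d1 y) -> ge k3 (d1 z) ->
  ge l1 (d2 x) -> ge l2 (d2 y) -> ge l3 (d2 z) ->
  ge l1 (d3 x) -> ge l2 (d3 y) -> ge l3 (d3 z) ->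
  k1 + l2 = l1 + k2 -> k2 + l3 = l2 + k3 ->
  ge (k1 + l2 + l3) (J x y z).
Proof.
move=> x1 y1 z1 x2 y2 z2 x3 y3 z3 e2 e3.
apply: geD; first apply: geD.
- by rewrite -addrA; apply: geM => //; apply: geD; [|apply: geN]; apply: geM.
- apply: geN.
  rewrite e2 -addrA.
  apply: geM => //; apply: geD; first exact: geM.
  by rewrite e3; apply: geN; apply: geM.
- rewrite e2 -addrA.
  apply: geM => //; apply: geD; first exact: geM.
  by rewrite e3; apply: geN; apply: geM.
Qed.

Let jacobian_val (x y z : E) : x != 0 -> y != 0 -> z != 0 -> J x y z != 0 ->
  v x + v y + v z <= v (J x y z).
Proof.
move=> x0 y0 z0 J0.
have G d : (forall x, x != 0 -> d x != 0 -> v x <= v (d x)) ->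
    forall x, x != 0 -> ge (v x) (d x).
  by move=> H t t0; rewrite /ge; have [|dt0] := eqVneq (d t) 0 => //=; apply: H.
have: ge (v x + v y + v z) (J x y z).
  by apply: (@jacobian_ge _ (v y) (v z) (v x)); rewrite ?G // addrC.
by rewrite /ge (negPf J0).
Qed.

Let jacobian_val_gt0 (x y z : E) : x != 0 -> y != 0 -> z != 0 -> J x y z != 0 ->
  0 <= v x -> 0 <= v y -> 0 <= v z -> 1 <= v (J x y z).
Proof.
move=> x0 y0 z0 J0 vx vy vz.
have G d : (forall x, x != 0 -> d x != 0 -> v x <= v (d x)) ->
    forall x, x != 0 -> 0 <= v x -> ge 0 (d x).
  move=> H t t0 vt; rewrite /ge; have [|dt0] := eqVneq (d t) 0 => //=.
  exact: le_trans vt (H _ t0 dt0).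
have G1 t : t != 0 -> 0 <= v t -> ge 1 (d1 t).
  by move=> t0 vt; rewrite /ge; have [|dt0] := eqVneq (d1 t) 0 => //=; apply: v_d1_gt0.
have: ge (1 + 0 + 0) (J x y z).
  by apply: (@jacobian_ge _ 1 1 0); rewrite ?G1 // ?G.
by rewrite /ge (negPf J0).
Qed.


Let ultrametric (x y z : E) : x + y = z -> x != 0 -> y != 0 -> z != 0 ->
  (v x <= v z \/ v y <= v z) /\ (v z <= v x \/ v y <= v x) /\
  (v x <= v y \/ v z <= v y).
Proof.
have H (a b : E) : a != 0 -> b != 0 -> a + b != 0 -> v a <= v (a + b) \/ v b <= v (a + b).
  move=> a0 b0 s0; have [ab|ba] := lerP (v a) (v b).
    by left; apply: vD.
  by right; apply: vD => //; apply: ltW.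
move=> <- x0 y0 s0; split; first exact: H.
split.
- have := H (x + y) (- y); rewrite addrK oppr_eq0 valN; exact.
- have := H (x + y) (- x); rewrite addrAC subrr add0r oppr_eq0 valN.
  by move=> /(_ s0 x0 y0) []; [right | left].
Qed.

Let valX2 (x : E) : x != 0 -> v (x ^+ 2) = 2 * v x.
Proof. by move=> x0; rewrite expr2 vM //; lia. Qed.

Let val_nat n : v n.+1%:R = 0. Proof. by case: (v_nat n). Qed.

Let nat_neq0 n : n.+1%:R != 0 :> E. Proof. by case: (v_nat n). Qed.


Let jacobian0 (x y z : E) : J x y z != 0 -> [/\ x != 0, y != 0 & z != 0].
Proof.
move=> j0; split; apply: contraNneq j0 => ->;
  by rewrite /jacobian !(derivation0 d1P, derivation0 d2P, derivation0 d3P); apply/eqP; ring.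
Qed.

Lemma branch_val p q u : J p q u != 0 ->
  branch p q u != 0 /\ v (branch p q u) < 2 * v (J p q u).
Proof.
rewrite /branch; set m := p - u; set n := q - u.
set g := 4 * q - m ^+ 2; set h := 4 * p - n ^+ 2.
set j := J p q u => j0.
have dE d : derivation d -> [/\ d m = d p - d u, d n = d q - d u,
    d g = 4 * d q - 2 * m * d m, d h = 4 * d p - 2 * n * d n &
    forall x k, d (x - k%:R) = d x].
  move=> dP; have dN := derivation_nat dP.
  have dg (x y : E) : d (4 * x - y ^+ 2) = 4 * d x - 2 * y * d y.
    by rewrite (derivationB dP) (derivation_sqr dP) (derivationM dP) dN mul0r add0r.
  by rewrite !dg /m /n !(derivationB dP); split=> // x k; rewrite (derivationB dP) dN subr0.
have [m1 n1 g1 h1 c1] := dE _ d1P.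
have [m2 n2 g2 h2 c2] := dE _ d2P.
have [m3 n3 g3 h3 c3] := dE _ d3P.
(* The Jacobian is alternating and ignores constants, so only the contribution of [u] survives next
   to [p] and [q]. The casts [a%:R] treat [p], [p - 1] and [p - 4] at once. *)
have Jpqm a b : J (p - a%:R) (q - b%:R) m = - j.
  by rewrite /J /j /jacobian !(m1, m2, m3, c1, c2, c3); ring.
have Jpqn a b : J (p - a%:R) (q - b%:R) n = - j.
  by rewrite /J /j /jacobian !(n1, n2, n3, c1, c2, c3); ring.
have Jpqg a b : J (p - a%:R) (q - b%:R) g = 2 * m * j.
  by rewrite /J /j /jacobian !(g1, g2, g3, m1, m2, m3, c1, c2, c3); ring.
have Jpqh a b : J (p - a%:R) (q - b%:R) h = 2 * n * j.
  by rewrite /J /j /jacobian !(h1, h2, h3, n1, n2, n3, c1, c2, c3); ring.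
have Jpgh : J p g h = 4 * n * (m + 2) * j.
  by rewrite /J /j /jacobian !(g1, g2, g3, m1, m2, m3, h1, h2, h3, n1, n2, n3); ring.
have Jqgh : J q g h = 4 * m * (n + 2) * j.
  by rewrite /J /j /jacobian !(g1, g2, g3, m1, m2, m3, h1, h2, h3, n1, n2, n3); ring.
have Jpqm2 : J p q (m + 2) = - j.
  by rewrite /J /j /jacobian !(derivationD d1P, derivationD d2P, derivationD d3P,
       derivation_nat d1P, derivation_nat d2P, derivation_nat d3P, m1, m2, m3); ring.
have Jpqn2 : J p q (n + 2) = - j.
  by rewrite /J /j /jacobian !(derivationD d1P, derivationD d2P, derivationD d3P,
       derivation_nat d1P, derivation_nat d2P, derivation_nat d3P, n1, n2, n3); ring.
have Nj0 : - j != 0 by rewrite oppr_eq0.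
(* A zero argument would make a Jacobian vanish; the multiples of [j] just computed thus show that
   each function to be valued is nonzero. *)
have [p0 q0 u0] := jacobian0 j0.
have /jacobian0 [p4 q4 m0] : J (p - 4) (q - 4) m != 0 by rewrite Jpqm.
have /jacobian0 [p5 _ n0] : J (p - 1%:R) (q - 4) n != 0 by rewrite Jpqn.
have /jacobian0 [_ _ m20] : J p q (m + 2) != 0 by rewrite Jpqm2.
have /jacobian0 [_ _ n20] : J p q (n + 2) != 0 by rewrite Jpqn2.
have Jg0 : 2 * m * j != 0 by rewrite !mulf_neq0 ?(nat_neq0 1).
have Jh0 : 2 * n * j != 0 by rewrite !mulf_neq0 ?(nat_neq0 1).
have /jacobian0 [_ _ g0] : J (p - 4) (q - 4) g != 0 by rewrite Jpqg.
have /jacobian0 [_ _ h0] : J (p - 4) (q - 4) h != 0 by rewrite Jpqh.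
split; first by rewrite !mulf_neq0.
have Jm (x y : E) : x != 0 -> y != 0 -> J x y m = - j -> v x + v y + v m <= v j.
  by move=> x0 y0 e; rewrite -[v j]valN -e jacobian_val // e.
have Jn (x y : E) : x != 0 -> y != 0 -> J x y n = - j -> v x + v y + v n <= v j.
  by move=> x0 y0 e; rewrite -[v j]valN -e jacobian_val // e.
have Jg (x y : E) : x != 0 -> y != 0 -> J x y g = 2 * m * j ->
    v x + v y + v g <= v m + v j.
  move=> x0 y0 e; suff -> : v m + v j = v (J x y g) by rewrite jacobian_val ?e.
  by rewrite e !vM ?mulf_neq0 ?(nat_neq0 1) // (val_nat 1) add0r.
have Jh (x y : E) : x != 0 -> y != 0 -> J x y h = 2 * n * j ->
    v x + v y + v h <= v n + v j.
  move=> x0 y0 e; suff -> : v n + v j = v (J x y h) by rewrite jacobian_val ?e.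
  by rewrite e !vM ?mulf_neq0 ?(nat_neq0 1) // (val_nat 1) add0r.
have J1 : 0 <= v p -> 0 <= v q -> 0 <= v m -> 1 <= v j.
  move=> vp vq vm.
  have vu : 0 <= v u.
    have e : u = p - m by rewrite /m; ring.
    by rewrite e; apply: vD; rewrite ?oppr_eq0 ?valN // -e.
  exact: jacobian_val_gt0 vp vq vu.
have Jgh1 : v p + v g + v h <= v n + v (m + 2) + v j.
  have e : v n + v (m + 2) + v j = v (J p g h).
    by rewrite Jpgh !vM ?mulf_neq0 ?(nat_neq0 3) // (val_nat 3); ring.
  by rewrite e jacobian_val // Jpgh !mulf_neq0 ?(nat_neq0 3).
have Jgh2 : v q + v g + v h <= v m + v (n + 2) + v j.
  have e : v m + v (n + 2) + v j = v (J q g h).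
    by rewrite Jqgh !vM ?mulf_neq0 ?(nat_neq0 3) // (val_nat 3); ring.
  by rewrite e jacobian_val // Jqgh !mulf_neq0 ?(nat_neq0 3).
have v4 : v (4 : E) = 0 by rewrite (val_nat 3).
have Up := @ultrametric (p - 4) 4 p (subrK _ _) p4 (nat_neq0 3) p0.
have Uq := @ultrametric (q - 4) 4 q (subrK _ _) q4 (nat_neq0 3) q0.
have Ug := @ultrametric g (m ^+ 2) (4 * q) (subrK _ _) g0 (expf_neq0 _ m0)
  (mulf_neq0 (nat_neq0 3) q0).
have Uh := @ultrametric h (n ^+ 2) (4 * p) (subrK _ _) h0 (expf_neq0 _ n0)
  (mulf_neq0 (nat_neq0 3) p0).
have vp1 : 0 < v h -> 0 < v (n + 2) -> 0 < v (p - 1%:R).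
  move=> vh vn2.
  (* The second factor [n - 2] is written [n + 2 - 4] so that its valuation is seen to be
     nonnegative from that of [n + 2]. *)
  have e : h + (n + 2) * (n + 2 - 4) = 4 * (p - 1%:R) by rewrite /h; ring.
  have <- : v (4 * (p - 1%:R)) = v (p - 1%:R) by rewrite vM ?nat_neq0 // v4 add0r.
  rewrite -e; have [z|z] := eqVneq (n + 2 - 4) 0.
    by rewrite z mulr0 addr0.
  have vz : 0 <= v (n + 2 - 4).
    by apply: vD => //; rewrite ?oppr_eq0 ?nat_neq0 // ?valN ?v4 // ltW.
  rewrite gtz0_ge1; apply: vD; rewrite ?mulf_neq0 ?nat_neq0 // ?e ?mulf_neq0 ?nat_neq0 //.
  by rewrite vM // -[1]addr0 lerD // -gtz0_ge1.
have v4M (x : E) : x != 0 -> v (4 * x) = v x.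
  by move=> x0; rewrite vM ?nat_neq0 // v4 add0r.
rewrite v4 in Up Uq; rewrite valX2 // v4M // in Ug; rewrite valX2 // v4M // in Uh.
rewrite !vM ?mulf_neq0 //.
(* [zeros] fails exactly when [p] or [q] specialises to 0, 4 or infinity. *)
pose zeros := [&& v p == 0, v q == 0, v (p - 4) == 0 & v (q - 4) == 0].
have [/and4P [/eqP vp0 /eqP vq0 /eqP vp4 /eqP vq4]|] := boolP zeros; last first.
  have base (x y : E) k l : x = p - k%:R -> y = q - l%:R -> x != 0 -> y != 0 ->
      2 * (v x + v y) + 2 * v g - v q <= 2 * v j /\
      2 * (v x + v y) + 2 * v h - v p <= 2 * v j.
    move=> ex ey x0 y0; split.
      apply: residual_bound_arith Ug; first by apply: Jm; rewrite // ex ey.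
      by apply: Jg; rewrite // ex ey.
    apply: residual_bound_arith Uh; first by apply: Jn; rewrite // ex ey.
    by apply: Jh; rewrite // ex ey.
  move=> nz; apply: special_base_arith nz => // b.
  rewrite !inE => /or4P [] /eqP ->.
  - by apply: (base p q 0 0); rewrite ?mulr0n ?subr0.
  - by apply: (base (p - 4) q 4 0); rewrite ?mulr0n ?subr0.
  - by apply: (base p (q - 4) 0 4); rewrite ?mulr0n ?subr0.
  - by apply: (base (p - 4) (q - 4) 4 4).
rewrite vp0 vq0 vp4 vq4 !add0r.
have V0 := (vp0, vq0).
have Jp0 (y x : E) : J p y x = J (p - 0%:R) y x by rewrite mulr0n subr0.
have Jq0 (y x : E) : J y q x = J y (q - 0%:R) x by rewrite mulr0n subr0.
apply: (@generic_base_arith (v (p - 1%:R)) (v m) (v n) (v g) (v h) (v (m + 2)) (v (n + 2))) => //.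
- by rewrite -vq0.
- by rewrite -vp0.
- by have := Jm p q p0 q0; rewrite !V0 !add0r; apply; rewrite Jp0 Jq0.
- by have := Jn p q p0 q0; rewrite !V0 !add0r; apply; rewrite Jp0 Jq0.
- by apply: J1; rewrite ?V0.
- by have := Jg p q p0 q0; rewrite !V0 !add0r; apply; rewrite Jp0 Jq0.
- by have := Jh p q p0 q0; rewrite !V0 !add0r; apply; rewrite Jp0 Jq0.
- by have := Jg _ _ p5 q0; rewrite !V0 addr0; apply; rewrite Jq0.
- by have := Jh _ _ p5 q0; rewrite !V0 addr0; apply; rewrite Jq0.
- by move: Jgh1; rewrite vp0 add0r.
- by move: Jgh2; rewrite vq0 add0r.
Qed.

End LogDiscrepancy.

(** * Derivations, morphisms and valuations on fraction fields *)

Section Fractions.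
Variable R : idomainType.
Implicit Types (f g : {fraction R}) (a b : R) (d : R -> R).

(** The representative is the one chosen by the quotient and need not be reduced. The lemmas
    [frac_deriv_div], [frac_morph_div] and [frac_val_div] show that the constructions below do not
    depend on it. *)
Definition fnum f : R := (frac (generic_quotient.repr f)).1.
Definition fden f : R := (frac (generic_quotient.repr f)).2.

Lemma fden_neq0 f : fden f != 0. Proof. exact: denom_ratioP. Qed.

Lemma tofrac_neq0 a : a != 0 -> a%:F != 0.
Proof. by rewrite tofrac_eq0. Qed.

Lemma fnum_fden f : f = (fnum f)%:F / (fden f)%:F.
Proof.
apply: (canRL (mulfK _)); first by rewrite tofrac_neq0 ?fden_neq0.
rewrite /fnum /fden -{1}[f]generic_quotient.reprK.
move: (generic_quotient.repr f) => x; unlock tofrac.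
rewrite -[LHS]FracField.pi_mul; apply/generic_quotient.eqmodP => /=.
rewrite FracField.equivfE /FracField.mulf /= !numden_Ratio ?oner_neq0 ?mulf_neq0 ?denom_ratioP //.
by rewrite !mulr1 mulrC.
all: exact: oner_neq0.
Qed.

Lemma tofrac_div_eq a b a' b' : b != 0 -> b' != 0 ->
  (a%:F / b%:F == a'%:F / b'%:F) = (a * b' == a' * b).
Proof. by move=> b0 b0'; rewrite eqr_div ?tofrac_neq0 // -!tofracM tofrac_eq. Qed.

Lemma fnum_fden_div a b : b != 0 -> fnum (a%:F / b%:F) * b = a * fden (a%:F / b%:F).
Proof.
by move=> b0; apply/eqP; rewrite -tofrac_div_eq ?fden_neq0 // -fnum_fden.
Qed.

Lemma tofrac_addf a b a' b' : b != 0 -> b' != 0 ->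
  a%:F / b%:F + a'%:F / b'%:F = (a * b' + a' * b)%:F / (b * b')%:F.
Proof. by move=> b0 b0'; rewrite addf_div ?tofrac_neq0 // tofracD !tofracM. Qed.

Lemma tofrac_mulf a b a' b' : a%:F / b%:F * (a'%:F / b'%:F) = (a * a')%:F / (b * b')%:F.
Proof. by rewrite mulf_div !tofracM. Qed.

Section Derivation.
Variable d : R -> R.
Hypothesis dP : derivation d.

Definition frac_deriv f : {fraction R} :=
  (d (fnum f) * fden f - fnum f * d (fden f))%:F / (fden f ^+ 2)%:F.

Lemma frac_deriv_div a b : b != 0 ->
  frac_deriv (a%:F / b%:F) = (d a * b - a * d b)%:F / (b ^+ 2)%:F.
Proof.
move=> b0; have := fnum_fden_div a b0; rewrite /frac_deriv.
move: (fnum _) (fden _) (fden_neq0 (a%:F / b%:F)) => a' b' b0' e.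
apply/eqP; rewrite tofrac_div_eq ?expf_neq0 //; apply/eqP.
(* Differentiating the equality of cross products compares the quotient rules for the two
   representatives. *)
have de : d a' * b + a' * d b = d a * b' + a * d b' by rewrite -!(derivationM dP) e.
transitivity (b * b' * (d a * b' + a * d b' - a' * d b) - (a' * b) * b * d b').
  by rewrite -de; ring.
by rewrite e; ring: e.
Qed.

Lemma frac_deriv_tofrac a : frac_deriv a%:F = (d a)%:F.
Proof.
have := frac_deriv_div a (oner_neq0 R); rewrite tofrac1 divr1 => ->.
rewrite (_ : d 1 = 0); last exact: (derivation_nat dP 1).
by rewrite expr1n mulr1 mulr0 subr0 tofrac1 divr1.
Qed.

Lemma frac_deriv_derivation : derivation frac_deriv.
Proof.
split=> f g; rewrite (fnum_fden f) (fnum_fden g);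
  move: (fnum f) (fden f) (fden_neq0 f) (fnum g) (fden g) (fden_neq0 g);
  move=> a b b0 a' b' b0'; have [bb0 bb0'] := (expf_neq0 2 b0, expf_neq0 2 b0').
  rewrite tofrac_addf // !frac_deriv_div ?mulf_neq0 // tofrac_addf //.
  apply/eqP; rewrite tofrac_div_eq ?expf_neq0 ?mulf_neq0 //; apply/eqP.
  by rewrite !(derivationM dP, derivationD dP); ring.
rewrite tofrac_mulf !frac_deriv_div ?mulf_neq0 // !tofrac_mulf tofrac_addf ?mulf_neq0 //.
apply/eqP; rewrite tofrac_div_eq ?expf_neq0 ?mulf_neq0 //; apply/eqP.
by rewrite !(derivationM dP); ring.
Qed.

End Derivation.

Section Morphism.
Variables (F : fieldType) (h : {rmorphism R -> F}).
Hypothesis h_inj : forall a, h a = 0 -> a = 0.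

(* The injectivity proof is an argument so that the morphism structure can be canonical. *)
Definition frac_morph of (forall a, h a = 0 -> a = 0) :=
  fun f : {fraction R} => h (fnum f) / h (fden f).

Lemma frac_morph_div a b : b != 0 -> frac_morph h_inj (a%:F / b%:F) = h a / h b.
Proof.
have h0 c : c != 0 -> h c != 0 by apply: contra_neq; apply: h_inj.
move=> b0; apply/eqP; rewrite eqr_div ?h0 ?fden_neq0 // -!rmorphM.
by rewrite fnum_fden_div.
Qed.

Lemma frac_morph_tofrac a : frac_morph h_inj a%:F = h a.
Proof.
by have := frac_morph_div a (oner_neq0 R); rewrite tofrac1 rmorph1 !divr1.
Qed.

Fact frac_morph_is_zmod_morphism : zmod_morphism (frac_morph h_inj).
Proof.
have h0 c : c != 0 -> h c != 0 by apply: contra_neq; apply: h_inj.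
move=> f g; rewrite {1}(fnum_fden f) {1}(fnum_fden g).
have [f0 g0] := (fden_neq0 f, fden_neq0 g).
have -> : (fnum f)%:F / (fden f)%:F - (fnum g)%:F / (fden g)%:F
    = (fnum f * fden g + - fnum g * fden f)%:F / (fden f * fden g)%:F.
  by rewrite -tofrac_addf // tofracN mulNr.
rewrite frac_morph_div ?mulf_neq0 // /frac_morph rmorphD !rmorphM rmorphN.
by rewrite -addf_div ?h0 // mulNr.
Qed.

Fact frac_morph_is_monoid_morphism : monoid_morphism (frac_morph h_inj).
Proof.
have h0 c : c != 0 -> h c != 0 by apply: contra_neq; apply: h_inj.
split=> [|f g]; first by rewrite -tofrac1 frac_morph_tofrac rmorph1.
rewrite {1}(fnum_fden f) {1}(fnum_fden g).
have [f0 g0] := (fden_neq0 f, fden_neq0 g).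
by rewrite tofrac_mulf frac_morph_div ?mulf_neq0 // /frac_morph !rmorphM mulf_div.
Qed.

HB.instance Definition _ := GRing.isZmodMorphism.Build {fraction R} F
  (frac_morph h_inj) frac_morph_is_zmod_morphism.
HB.instance Definition _ := GRing.isMonoidMorphism.Build {fraction R} F
  (frac_morph h_inj) frac_morph_is_monoid_morphism.

End Morphism.

(** * Valuations on the fraction field and transfer of the local estimate *)

Section Place.
Variable v : R -> int.
Hypothesis vM : forall a b, a != 0 -> b != 0 -> v (a * b) = v a + v b.
Hypothesis vD : forall a b (k : int), a != 0 -> b != 0 -> a + b != 0 ->
  k <= v a -> k <= v b -> k <= v (a + b).

Definition frac_val f : int := v (fnum f) - v (fden f).

Lemma frac_val_div a b : a != 0 -> b != 0 -> frac_val (a%:F / b%:F) = v a - v b.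
Proof.
move=> a0 b0; have := fnum_fden_div a b0; rewrite /frac_val.
have : fnum (a%:F / b%:F) != 0.
  apply: contra_neq (mulf_neq0 (tofrac_neq0 a0) (invr_neq0 (tofrac_neq0 b0))).
  by rewrite {2}(fnum_fden (_ / _)) => ->; rewrite tofrac0 mul0r.
move: (fnum _) (fden _) (fden_neq0 (a%:F / b%:F)) => a' b' b0' a0' e.
by have := vM a0' b0; rewrite e vM //; lia.
Qed.

Lemma fnum_neq0 f : f != 0 -> fnum f != 0.
Proof. by apply: contra_neq => e; rewrite (fnum_fden f) e tofrac0 mul0r. Qed.

Lemma frac_valM f g : f != 0 -> g != 0 -> frac_val (f * g) = frac_val f + frac_val g.
Proof.
move=> /fnum_neq0 f0 /fnum_neq0 g0.
rewrite {1}(fnum_fden f) {1}(fnum_fden g) mulf_div -!tofracM.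
by rewrite frac_val_div ?mulf_neq0 ?fden_neq0 // !vM ?fden_neq0 // /frac_val; lia.
Qed.

Lemma frac_valD f g (k : int) : f != 0 -> g != 0 -> f + g != 0 ->
  k <= frac_val f -> k <= frac_val g -> k <= frac_val (f + g).
Proof.
move=> f0 g0; have [f1 g1] := (fnum_neq0 f0, fnum_neq0 g0).
have [f2 g2] := (fden_neq0 f, fden_neq0 g).
have -> : f + g = (fnum f * fden g + fnum g * fden f)%:F / (fden f * fden g)%:F.
  by rewrite {1}(fnum_fden f) {1}(fnum_fden g) tofrac_addf.
move=> s0; have {}s0 : fnum f * fden g + fnum g * fden f != 0.
  by apply: contra_neq s0 => ->; rewrite tofrac0 mul0r.
rewrite /frac_val => kf kg; rewrite -/(frac_val _) frac_val_div ?mulf_neq0 // lerBrDr.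
by rewrite (vM f2 g2); apply: vD; rewrite ?mulf_neq0 // vM //; move: kf kg; clear; lia.
Qed.

Hypothesis v_nat : forall n, n.+1%:R != 0 :> R /\ v n.+1%:R = 0.
Variables d1 d2 d3 : R -> R.
Hypotheses (d1P : derivation d1) (d2P : derivation d2) (d3P : derivation d3).
Hypothesis v_d1 : forall a, a != 0 -> d1 a != 0 -> v a <= v (d1 a).
Hypothesis v_d2 : forall a, a != 0 -> d2 a != 0 -> v a <= v (d2 a).
Hypothesis v_d3 : forall a, a != 0 -> d3 a != 0 -> v a <= v (d3 a).
Hypothesis v_d1_gt : forall a b, a != 0 -> b != 0 -> v a = v b ->
  d1 a * b - a * d1 b != 0 -> v a + v b < v (d1 a * b - a * d1 b).

Let v_opp a : v (- a) = v a.
Proof.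
have [->|a0] := eqVneq a 0; first by rewrite oppr0.
have N0 : - 1 != 0 :> R by rewrite oppr_eq0 oner_eq0.
have v1 : v 1 = 0 by case: (v_nat 0).
have vN1 : v (-1) = 0 by have := vM N0 N0; rewrite mulrNN mulr1 v1; clear; lia.
by rewrite -mulN1r vM // vN1 add0r.
Qed.

Let geD (k : int) a b : (a != 0 -> k <= v a) -> (b != 0 -> k <= v b) ->
  a + b != 0 -> k <= v (a + b).
Proof.
have [->|a0] := eqVneq a 0; first by rewrite add0r => _.
have [->|b0] := eqVneq b 0; first by rewrite addr0 => + _ s0; apply.
by move=> ka kb s0; apply: vD => //; [apply: ka|apply: kb].
Qed.

Let frac_deriv_val d f : derivation d ->
  (forall a, a != 0 -> d a != 0 -> v a <= v (d a)) -> f != 0 -> frac_deriv d f != 0 ->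
  frac_val f <= frac_val (frac_deriv d f).
Proof.
move=> dP vd f0; have := fden_neq0 f; have := fnum_neq0 f0.
rewrite /frac_deriv /frac_val; move: (fnum f) (fden f) => a b a0 b0.
rewrite -/(frac_val _) mulf_eq0 negb_or => /andP[].
rewrite tofrac_eq0 => n0 _; rewrite frac_val_div ?expf_neq0 //.
have vb2 : v (b ^+ 2) = v b + v b by rewrite expr2 vM.
suff : v a + v b <= v (d a * b - a * d b) by rewrite vb2; clear; lia.
apply: geD n0; rewrite ?oppr_eq0 mulf_eq0 negb_or => /andP[x0 y0].
  by rewrite vM // lerD2r vd.
by rewrite v_opp vM // lerD2l vd.
Qed.

(** The hypotheses of [branch_val] pass from the ring to its fractions by the quotient rule. The
    condition [v_d1_gt] is what makes [d1] send a fraction of valuation 0 to one of valuation at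
    least 1. *)
Lemma place_branch_val p q u :
  let J := jacobian (frac_deriv d1) (frac_deriv d2) (frac_deriv d3) p q u in
  J != 0 -> branch p q u != 0 /\ frac_val (branch p q u) < 2 * frac_val J.
Proof.
move=> J J0; apply: branch_val => //; try exact: frac_deriv_derivation.
- exact: frac_valM.
- exact: frac_valD.
- move=> n; have [n0 vn] := v_nat n; have [_ v1] := v_nat 0.
  split; first by rewrite -tofrac1 -tofracMn tofrac_eq0.
  have := frac_val_div n0 (oner_neq0 R).
  by rewrite tofrac1 divr1 tofracMn tofrac1 => ->; rewrite vn v1 subr0.
- by move=> f; apply: frac_deriv_val.
- by move=> f; apply: frac_deriv_val.
- by move=> f; apply: frac_deriv_val.
move=> f f0 df0 vf; have [|vf1] := ltrP 0 (frac_val f).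
  by rewrite gtz0_ge1 => /le_trans; apply; apply: frac_deriv_val.
move: df0 vf vf1; have := fden_neq0 f; have := fnum_neq0 f0.
rewrite /frac_deriv /frac_val; move: (fnum f) (fden f) => a b a0 b0.
rewrite -/(frac_val _) mulf_eq0 negb_or => /andP[].
rewrite tofrac_eq0 => n0 _ vf vf1; rewrite frac_val_div ?expf_neq0 //.
have vab : v a = v b by apply/eqP; rewrite eq_le -subr_le0 vf1 -subr_ge0.
have vb2 : v (b ^+ 2) = v b + v b by rewrite expr2 vM.
by have := v_d1_gt a0 b0 vab n0; rewrite vb2 vab; clear; lia.
Qed.

End Place.
End Fractions.

(** * Places of K(t) *)

Section Multiplicity.
Variables (K : fieldType) (p : {poly K}).
Hypothesis p_irr : irreducible_poly p.
Implicit Types a b : {poly K}.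

(** The range [k < size a] loses nothing for nonzero [a], because [p] is not constant; for [a = 0]
    the maximum is empty and equals 0. *)
Definition mult a : nat := \max_(k < size a | p ^+ k %| a) k.

Let p0 : p != 0. Proof. exact: irredp_neq0. Qed.
Let p_gt1 : (1 < size p)%N. Proof. by case: p_irr. Qed.

Lemma irredp_dvdM a b : (p %| a * b) = (p %| a) || (p %| b).
Proof.
apply/idP/orP => [|[]]; [|exact: dvdp_mulr|exact: dvdp_mull].
have [pa|pa] := boolP (p %| a); first by left.
by rewrite Gauss_dvdpr ?irreducible_poly_coprime //; right.
Qed.

Lemma multE k a : ~~ (p %| a) -> mult (p ^+ k * a) = k.
Proof.
move=> pa; have a0 : a != 0 by apply: contraNneq pa => ->; rewrite dvdp0.
have b0 : p ^+ k * a != 0 by rewrite mulf_neq0 ?expf_neq0.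
have szk : (k < size (p ^+ k * a)%R)%N.
  apply: leq_trans (dvdp_leq b0 (dvdp_mulIl _ _)).
  elim: k {b0} => [|k IHk]; first by rewrite expr0 size_poly1.
  rewrite exprS size_mul ?expf_neq0 // -ltnS prednK ?addn_gt0 ?(ltnW p_gt1) //.
  exact: (leq_add p_gt1 IHk).
apply/eqP; rewrite eqn_leq; apply/andP; split; last first.
  by apply: (@leq_bigmax_cond _ _ _ (Ordinal szk)); rewrite /= dvdp_mulIl.
apply/bigmax_leqP => -[j /= _] pj; rewrite leqNgt; apply: contra pa => kj.
have : p ^+ k.+1 %| p ^+ k * a by apply: dvdp_trans pj; apply: dvdp_exp2l.
by rewrite exprSr dvdp_mul2l ?expf_neq0.
Qed.

Lemma mult_spec a : a != 0 -> exists2 b, a = p ^+ mult a * b & ~~ (p %| b).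
Proof.
move=> a0; suff [k [b e pb]] : exists k, exists2 b, a = p ^+ k * b & ~~ (p %| b).
  by exists b; rewrite // e multE.
have [n] := ubnP (size a); elim: n => // n IHn in a a0 *; rewrite ltnS => an.
have [/dvdpP [b e]|pa] := boolP (p %| a); last by exists 0%N, a; rewrite ?mul1r.
have b0 : b != 0 by apply: contra_neq a0 => b0; rewrite e b0 mul0r.
have [|k [c eb pc]] := IHn b b0.
  rewrite e size_mul // in an; apply: leq_trans an.
  by rewrite -ltnS prednK ?addn_gt0 ?(ltnW p_gt1) ?orbT // -addn2 leq_add2l.
by exists k.+1, c => //; rewrite e eb exprS; ring.
Qed.

Lemma multM a b : a != 0 -> b != 0 -> mult (a * b) = (mult a + mult b)%N.
Proof.
move=> /mult_spec [a' ea pa] /mult_spec [b' eb pb].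
rewrite {1}ea {1}eb mulrACA -exprD multE // irredp_dvdM negb_or pa pb //.
Qed.

Lemma leq_mult k a : a != 0 -> (k <= mult a)%N = (p ^+ k %| a).
Proof.
move=> /mult_spec [b e pb]; apply/idP/idP => [ka|].
  by rewrite e dvdp_mulr // dvdp_exp2l.
rewrite {1}e leqNgt => pk; apply/negP => ka; move: pb.
rewrite -[p %| b](@dvdp_mul2l _ (p ^+ mult a)) ?expf_neq0 // -exprSr.
by move/negP; apply; apply: dvdp_trans pk; apply: dvdp_exp2l.
Qed.

Lemma multD k a b : a != 0 -> b != 0 -> a + b != 0 ->
  (k <= mult a)%N -> (k <= mult b)%N -> (k <= mult (a + b))%N.
Proof. by move=> a0 b0 s0; rewrite !leq_mult //; apply: dvdp_add. Qed.

Lemma mult_gt0 a : a != 0 -> (0 < mult a)%N = (p %| a).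
Proof. exact: (@leq_mult 1). Qed.

(** By the Leibniz rule, a derivation that preserves the ideal of [p] preserves the ideals of all
    its powers; hence it is logarithmic for [mult]. *)
Lemma derivation_exp (d : {poly K} -> {poly K}) : derivation d -> p %| d p ->
  forall k, p ^+ k %| d (p ^+ k).
Proof.
move=> dP pd; elim=> [|k IHk]; first exact: dvd1p.
rewrite exprS (derivationM dP) dvdp_add //; first exact: dvdp_mul.
exact: dvdp_mul.
Qed.

Lemma mult_derivation (d : {poly K} -> {poly K}) a : derivation d -> p %| d p ->
  a != 0 -> d a != 0 -> (mult a <= mult (d a))%N.
Proof.
move=> dP pd a0 da0; rewrite leq_mult //; have [b {2}-> _] := mult_spec a0.
by rewrite (derivationM dP) dvdp_add // ?dvdp_mulr ?derivation_exp.
Qed.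

End Multiplicity.

(** The existence of an irreducible factor is doubly negated because irreducibility over an
    arbitrary field is not decidable. This is enough for an argument by contradiction. *)
Lemma irredp_factor (K : fieldType) (b : {poly K}) :
  (1 < size b)%N -> ~ (forall p, irreducible_poly p -> ~~ (p %| b)).
Proof.
have [n] := ubnP (size b); elim: n => // n IHn in b *; rewrite ltnS => bn b1 H.
have b0 : b != 0 by rewrite -size_poly_gt0; apply: ltnW.
suff /H : irreducible_poly b by rewrite dvdpp.
split=> // q q1 qb; apply/negPn/negP => nqb.
have qltb : (size q < size b)%N.
  rewrite ltn_neqAle dvdp_leq // andbT; apply: contra nqb => szq.
  by rewrite -dvdp_size_eqp.
have q_gt1 : (1 < size q)%N.
  rewrite ltn_neqAle eq_sym q1 size_poly_gt0.
  by apply: contra_neq b0 => q0; move: qb; rewrite q0 dvd0p => /eqP.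
apply: (IHn q (leq_trans qltb bn) q_gt1) => p p_irr.
by apply: contra (H _ p_irr) => /dvdp_trans; apply.
Qed.

Lemma derivation_comb (R : comNzRingType) (d e : R -> R) (b c : R) :
  derivation d -> derivation e -> derivation (fun a => c * d a - b * e a).
Proof.
move=> dP eP; split=> x y.
  by rewrite (derivationD dP) (derivationD eP); ring.
by rewrite (derivationM dP) (derivationM eP); ring.
Qed.

Lemma derivation_scale (R : comNzRingType) (d : R -> R) (c : R) :
  derivation d -> derivation (fun a => c * d a).
Proof.
move=> dP; split=> x y.
  by rewrite (derivationD dP); ring.
by rewrite (derivationM dP); ring.
Qed.

(** The [e_i] come from the [d_i] by a triangular matrix with diagonal [c], [b], [b]. *)
Lemma jacobian_comb (R : comNzRingType) (d1 d2 d3 e1 e2 e3 : R -> R) (c b b2 b3 : R) :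
  (forall x, e1 x = c * d1 x) -> (forall x, e2 x = b * d2 x - b2 * d1 x) ->
  (forall x, e3 x = b * d3 x - b3 * d1 x) ->
  forall x y z, jacobian e1 e2 e3 x y z = c * b ^+ 2 * jacobian d1 d2 d3 x y z.
Proof. by move=> h1 h2 h3 x y z; rewrite /jacobian !h1 !h2 !h3; ring. Qed.

Lemma frac_deriv_comb (R : idomainType) (d e : R -> R) (b c : R) f :
  frac_deriv (fun a => c * d a - b * e a) f
  = c%:F * frac_deriv d f - b%:F * frac_deriv e f.
Proof.
rewrite /frac_deriv !mulrA -!tofracM -mulrBl -tofracB.
by congr (_%:F / _); ring.
Qed.

Lemma frac_deriv_scale (R : idomainType) (d : R -> R) (c : R) f :
  frac_deriv (fun a => c * d a) f = c%:F * frac_deriv d f.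
Proof. by rewrite /frac_deriv !mulrA -!tofracM; congr (_%:F / _); ring. Qed.

Lemma frac_val_tofrac (R : idomainType) (v : R -> int) (a : R) :
  (forall a b, a != 0 -> b != 0 -> v (a * b) = v a + v b) -> a != 0 ->
  frac_val v a%:F = v a.
Proof.
move=> vM a0; have := frac_val_div vM a0 (oner_neq0 R).
have := vM _ _ (oner_neq0 R) (oner_neq0 R); rewrite tofrac1 divr1 mulr1 => v1 ->.
by move: v1; clear; lia.
Qed.

Lemma coprime_fraction (K : fieldType) (f : {fraction {poly K}}) : f != 0 ->
  exists a b, [/\ a != 0, b != 0, coprimep a b & f = a%:F / b%:F].
Proof.
move=> f0; have [a0 b0] := (fnum_neq0 f0, fden_neq0 f).
set a := fnum f; set b := fden f; pose g := gcdp a b.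
have ea : a = a %/ g * g by rewrite divpK ?dvdp_gcdl.
have eb : b = b %/ g * g by rewrite divpK ?dvdp_gcdr.
have a1 : a %/ g != 0 by apply: contra_neq a0 => e; rewrite -/a ea e mul0r.
have b1 : b %/ g != 0 by apply: contra_neq b0 => e; rewrite -/b eb e mul0r.
exists (a %/ g), (b %/ g); split=> //; first by rewrite coprimep_div_gcd ?a0.
rewrite {1}(fnum_fden f); apply/eqP; rewrite tofrac_div_eq //.
by rewrite -/a -/b {1}ea {2}eb; apply/eqP; ring.
Qed.

Lemma factor_neq0 (E : fieldType) (x y : E) : x != 0 -> y != 0 ->
  exists2 f, f != 0 & x = f * y.
Proof.
move=> x0 y0; exists (x / y); last by rewrite divfK.
by rewrite mulf_neq0 ?invr_eq0.
Qed.

(** * Vanishing of the Jacobian on the projective line *)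

Section Uniruled.
Variable K : fieldType.
Hypothesis K_char0 : forall n, n.+1%:R != 0 :> K.
Variables D2 D3 : K -> K.
Hypotheses (D2P : derivation D2) (D3P : derivation D3).

Lemma deriv_derivation : derivation (@deriv K).
Proof. by split=> a b; rewrite ?derivD ?derivM. Qed.

Lemma map_poly_derivation (D : K -> K) : derivation D -> derivation (map_poly D).
Proof.
move=> DP; have D0 := derivation0 DP; split=> a b; apply/polyP => i.
  by rewrite !(coefD, coef_map_id0) // (derivationD DP).
rewrite !(coefD, coef_map_id0, coefM) // (derivation_sum DP) -big_split.
by apply: eq_bigr => j _; rewrite (derivationM DP) !coef_map_id0.
Qed.

Local Notation dt := (@deriv K).
Local Notation Jac := (jacobian (frac_deriv dt) (frac_deriv (map_poly D2))
  (frac_deriv (map_poly D3))).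

Let poly_nat n : n.+1%:R != 0 :> {poly K}.
Proof. by rewrite -polyC_natr polyC_eq0. Qed.

Section FinitePlace.
Variable pi : {poly K}.
Hypothesis pi_irr : irreducible_poly pi.
Definition finite_val (a : {poly K}) : int := (mult pi a)%:Z.
Local Notation v := finite_val.

Lemma finite_valM (a b : {poly K}) : a != 0 -> b != 0 -> v (a * b) = v a + v b.
Proof. by move=> a0 b0; rewrite /finite_val multM // PoszD. Qed.

Let vD (a b : {poly K}) (k : int) : a != 0 -> b != 0 -> a + b != 0 ->
  k <= v a -> k <= v b -> k <= v (a + b).
Proof.
by case: k => // k a0 b0 s0; rewrite /finite_val !lez_nat; apply: multD.
Qed.

Let v_size (a : {poly K}) : a != 0 -> (size a < size pi)%N -> v a = 0.
Proof.
move=> a0 sz; apply/eqP; rewrite /finite_val eqz_nat -leqn0 leqNgt mult_gt0 //.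
by apply: contraL sz => /(dvdp_leq a0); rewrite leqNgt.
Qed.

Let v_nat n : n.+1%:R != 0 :> {poly K} /\ v n.+1%:R = 0.
Proof.
split=> //; rewrite v_size // -polyC_natr size_polyC K_char0.
by case: pi_irr.
Qed.

Let dpi0 : pi^`() != 0.
Proof.
have /(congr1 (fun n => n.-1)) : size pi = (size pi).-2.+2.
  by case: pi_irr => + _; case: (size pi) => [|[]].
move=> /= sz; apply/eqP => /(congr1 (fun a : {poly K} => a`_(size pi).-2)).
rewrite coef0 coef_deriv -sz -mulr_natr => /eqP; rewrite mulf_eq0 sz.
rewrite (negPf (K_char0 _)) orbF -sz -/(lead_coef _) lead_coef_eq0.
by rewrite (negPf (irredp_neq0 pi_irr)).
Qed.

Let v_dpi : v pi^`() = 0.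
Proof. by rewrite v_size // lt_size_deriv // irredp_neq0. Qed.

Let v_pi : v pi = 1.
Proof.
rewrite /finite_val -[pi in mult _ pi]mulr1 -[X in mult _ (X * _)]expr1 multE //.
by rewrite dvdp1; case: pi_irr => + _; case: (size pi) => [|[]].
Qed.

Lemma finite_place_val p q u : Jac p q u != 0 ->
  frac_val v (branch p q u) < 2 * (1 + frac_val v (Jac p q u)).
Proof.
(* These derivations map pi into (pi), hence preserve every power of (pi). *)
pose d1 a := pi * dt a.
pose d (D : K -> K) a := pi^`() * map_poly D a - map_poly D pi * dt a.
have dP D : derivation D -> derivation (d D).
  move=> DP; apply: derivation_comb; last exact: deriv_derivation.
  exact: map_poly_derivation.
have d1P : derivation d1 by apply: derivation_scale; apply: deriv_derivation.
have pi0 := irredp_neq0 pi_irr.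
move=> J0.
have J'E : jacobian (frac_deriv d1) (frac_deriv (d D2)) (frac_deriv (d D3)) p q u
    = pi%:F * pi^`()%:F ^+ 2 * Jac p q u.
  apply: (jacobian_comb (b2 := (map_poly D2 pi)%:F) (b3 := (map_poly D3 pi)%:F)) => x.
  - exact: frac_deriv_scale.
  - exact: frac_deriv_comb.
  - exact: frac_deriv_comb.
have c0 : pi%:F * pi^`()%:F ^+ 2 != 0.
  by rewrite mulf_neq0 ?expf_neq0 ?tofrac_neq0.
have J'0 : jacobian (frac_deriv d1) (frac_deriv (d D2)) (frac_deriv (d D3)) p q u != 0.
  by rewrite J'E; exact: (mulf_neq0 c0 J0).
have vd D a : derivation D -> a != 0 -> d D a != 0 -> v a <= v (d D a).
  move=> DP a0 da0; rewrite lez_nat; apply: mult_derivation => //; first exact: dP.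
  by rewrite /d mulrC subrr dvdp0.
have vd1 a : a != 0 -> d1 a != 0 -> v a <= v (d1 a).
  by move=> a0 da0; rewrite lez_nat; apply: mult_derivation => //; apply: dvdp_mulIl.
have vd1_gt (a b : {poly K}) : a != 0 -> b != 0 -> v a = v b ->
    d1 a * b - a * d1 b != 0 -> v a + v b < v (d1 a * b - a * d1 b).
  (* Writing [a] and [b] as [pi ^+ k] times cofactors, the terms that differentiate [pi ^+ k]
     cancel, and the factor [pi] of [d1] gives divisibility by [pi ^+ (2 k + 1)]. *)
  move=> a0 b0 [] vab n0; rewrite -PoszD ltz_nat leq_mult //.
  have [a' ea _] := mult_spec pi_irr a0; have [b' eb _] := mult_spec pi_irr b0.
  move: ea eb; rewrite -vab; move: (mult pi a) => k -> ->.
  rewrite exprSr exprD; apply/dvdpP; exists (a'^`() * b' - a' * b'^`()).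
  by rewrite /d1 !derivM; ring.
have [_] := place_branch_val finite_valM vD v_nat d1P (dP _ D2P) (dP _ D3P) vd1
  (fun a => vd _ a D2P) (fun a => vd _ a D3P) vd1_gt J'0.
rewrite J'E (frac_valM finite_valM c0 J0).
have [pF dF] := (tofrac_neq0 pi0, tofrac_neq0 dpi0).
have -> : frac_val v (pi%:F * pi^`()%:F ^+ 2) = 1.
  rewrite expr2 !(frac_valM finite_valM) ?mulf_neq0 //.
  by rewrite (frac_val_tofrac finite_valM pi0) (frac_val_tofrac finite_valM dpi0) v_pi v_dpi.
by [].
Qed.

End FinitePlace.

Section InfinitePlace.
Definition infinite_val (a : {poly K}) : int := 1 - (size a)%:Z.
Local Notation v := infinite_val.

Lemma infinite_valM (a b : {poly K}) : a != 0 -> b != 0 -> v (a * b) = v a + v b.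
Proof.
move=> a0 b0; rewrite /infinite_val size_mul //.
move: a0 b0; rewrite -!size_poly_gt0; move: (size a) (size b); clear; lia.
Qed.

Let vD (a b : {poly K}) (k : int) : a != 0 -> b != 0 -> a + b != 0 ->
  k <= v a -> k <= v b -> k <= v (a + b).
Proof.
move=> _ _ _; have := size_polyD a b; rewrite /infinite_val.
move: (size a) (size b) (size _); clear; lia.
Qed.

Let v_nat n : n.+1%:R != 0 :> {poly K} /\ v n.+1%:R = 0.
Proof. by split=> //; rewrite /infinite_val -polyC_natr size_polyC K_char0. Qed.

Let size_mulX_deriv (a : {poly K}) : (size ('X * a^`())%R <= size a)%N.
Proof.
have [->|a0] := eqVneq a 0; first by rewrite deriv0 mulr0.
have [->|da0] := eqVneq a^`() 0; first by rewrite mulr0 size_poly0.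
by rewrite mulrC size_mulX // lt_size_deriv.
Qed.

(** The derivation ['X * d/dt] is logarithmic at infinity, and ['X] has valuation -1 there. The
    resulting bound makes [Jac / w] vanish to order at least 2, reflecting the double pole of [dt]
    at infinity. *)
Lemma infinite_place_val p q u : Jac p q u != 0 -> branch p q u != 0 /\
  frac_val v (branch p q u) < 2 * (frac_val v (Jac p q u) - 1).
Proof.
pose d1 (a : {poly K}) := 'X * dt a.
have d1P : derivation d1 by apply: derivation_scale; apply: deriv_derivation.
have X0 : 'X != 0 :> {poly K} by rewrite polyX_eq0.
move=> J0.
have J'E : jacobian (frac_deriv d1) (frac_deriv (map_poly D2)) (frac_deriv (map_poly D3)) p q u
    = 'X%:F * Jac p q u.
  rewrite (@jacobian_comb _ (frac_deriv dt) (frac_deriv (map_poly D2))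
     (frac_deriv (map_poly D3)) _ _ _ 'X%:F 1 0 0) => [|x|x|x].
  - by rewrite expr1n mulr1.
  - exact: frac_deriv_scale.
  - by rewrite mul1r mul0r subr0.
  - by rewrite mul1r mul0r subr0.
have J'0 : jacobian (frac_deriv d1) (frac_deriv (map_poly D2)) (frac_deriv (map_poly D3))
    p q u != 0.
  by rewrite J'E; exact: (mulf_neq0 (tofrac_neq0 X0) J0).
have vd D a : derivation D -> a != 0 -> map_poly D a != 0 -> v a <= v (map_poly D a).
  by move=> _ _ _; rewrite lerD2l lerN2 lez_nat; apply: size_poly.
have vd1 a : a != 0 -> d1 a != 0 -> v a <= v (d1 a).
  by move=> _ _; rewrite lerD2l lerN2 lez_nat; apply: size_mulX_deriv.
have vd1_gt (a b : {poly K}) : a != 0 -> b != 0 -> v a = v b ->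
    d1 a * b - a * d1 b != 0 -> v a + v b < v (d1 a * b - a * d1 b).
  move=> a0 b0 vab _; have szab : size a = size b by move: vab; rewrite /infinite_val; clear; lia.
  (* The expression is unchanged when a is replaced by a - l b, of smaller degree. *)
  pose l := lead_coef a / lead_coef b; pose c := a - l *: b.
  have szc : (size c < size a)%N.
    rewrite -[in ltnRHS](prednK (_ : 0 < size a)%N) ?size_poly_gt0 // ltnS.
    apply/leq_sizeP => j; rewrite leq_eqVlt => /predU1P [<-|].
      rewrite coefB coefZ {2}szab -!/(lead_coef _) /l divfK ?subrr //.
      by rewrite lead_coef_eq0.
    rewrite prednK ?size_poly_gt0 // => aj; rewrite coefB coefZ.
    by rewrite !nth_default ?mulr0 ?subr0 // -szab.
  have -> : d1 a * b - a * d1 b = d1 c * b - c * d1 b.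
    by rewrite /d1 /c derivB derivZ -!mul_polyC; ring.
  have := size_polyD (d1 c * b) (- (c * d1 b)); rewrite size_polyN.
  have := size_mul_leq (d1 c) b; have := size_mul_leq c (d1 b).
  have := size_mulX_deriv c; have := size_mulX_deriv b.
  move: szc; rewrite /infinite_val szab -/(d1 c) -/(d1 b); rewrite -size_poly_gt0 in b0.
  move: b0 (size b) (size c) (size (d1 c)) (size (d1 b)) (size (d1 c * b)%R)
    (size (c * d1 b)%R) (size (d1 c * b - c * d1 b)%R).
  by move=> + sb sc sdc sdb s1 s2 s3; clear; lia.
have [B0] := place_branch_val infinite_valM vD v_nat d1P (map_poly_derivation D2P)
  (map_poly_derivation D3P) vd1 (fun a => vd _ a D2P) (fun a => vd _ a D3P) vd1_gt J'0.
rewrite J'E (frac_valM infinite_valM (tofrac_neq0 X0) J0) (frac_val_tofrac infinite_valM X0).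
by rewrite {2}/infinite_val size_polyX addrC; split.
Qed.

End InfinitePlace.

(* J / w is a function on the projective line over K without poles, vanishing at
   infinity. *)
Lemma branch_square_jacobian (p q u w : {fraction {poly K}}) :
  w ^+ 2 = branch p q u -> Jac p q u = 0.
Proof.
move=> wS; apply/eqP/negPn/negP => J0.
have [S0 vinf] := infinite_place_val J0.
have vfin pi (pi_irr : irreducible_poly pi) := finite_place_val pi_irr J0.
move: (Jac p q u) (branch p q u) J0 S0 wS vinf vfin => J S J0 S0 wS vinf vfin.
have w0 : w != 0 by apply: contra_neq S0 => w0; rewrite -wS w0 expr0n.
have [f f0 Jfw] := factor_neq0 J0 w0.
have vw (v : {poly K} -> int) : (forall a b, a != 0 -> b != 0 -> v (a * b) = v a + v b) ->
    frac_val v S = 2 * frac_val v w /\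
    frac_val v J = frac_val v f + frac_val v w.
  move=> vM; rewrite -wS Jfw expr2; split; last exact (frac_valM vM f0 w0).
  by rewrite (frac_valM vM w0 w0) mulrDl mul1r.
have [a [b [a0 b0 ab fE]]] := coprime_fraction f0.
(* A nonconstant [b] would have an irreducible factor, at which [f = J / w] would have a pole; so
   [f] is a polynomial. *)
have [b1|b_gt1] := leqP (size b) 1; last first.
  apply: (irredp_factor b_gt1) => pi pi_irr; apply/negP => pib.
  have vM := finite_valM pi_irr; have [vS vJ] := vw _ vM.
  have := vfin pi pi_irr.
  rewrite vS vJ fE (frac_val_div vM a0 b0) /finite_val.
  have : (0 < mult pi b)%N by rewrite mult_gt0.
  have : mult pi a = 0%N.
    apply/eqP; rewrite -leqn0 leqNgt mult_gt0 //; apply/negP => pia.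
    have := coprimep_dvdr pia ab.
    by rewrite irreducible_poly_coprime // pib.
  move=> ->; move: (mult pi b) (frac_val _ w); clear; lia.
(* A nonzero polynomial has valuation minus its degree at infinity, which contradicts a zero
   there. *)
have vM := infinite_valM; have [vS vJ] := vw _ vM.
move: vinf; rewrite vS vJ fE (frac_val_div vM a0 b0) /infinite_val.
move: a0 b1; rewrite -size_poly_gt0.
move: (size a) (size b) (frac_val _ w); clear; lia.
Qed.

End Uniruled.

(** * Derivations vanishing on a subfield of full transcendence degree *)

Lemma linear_dependence (K : fieldType) (I J : finType) (u : I -> J -> K) :
  (#|J| < #|I|)%N ->
  exists2 c : I -> K, exists i, c i != 0 & forall j, \sum_i c i * u i j = 0.
Proof.
move=> JI; pose A : 'M[K]_(#|I|, #|J|) := \matrix_(i, j) u (enum_val i) (enum_val j).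
have : kermx A != 0.
  by rewrite -mxrank_eq0 mxrank_ker -lt0n subn_gt0 (leq_ltn_trans (rank_leq_col A)).
case/rowV0Pn => v /sub_kermxP vA v0; have [k vk] : exists k, v 0 k != 0.
  apply/existsP; apply: contraNT v0 => /existsPn v0; apply/eqP/rowP => k.
  by rewrite mxE; apply/eqP/negPn.
exists (fun i => v 0 (enum_rank i)); first by exists (enum_val k); rewrite enum_valK.
move=> j; have /matrixP/(_ 0 (enum_rank j)) := vA; rewrite !mxE => e; rewrite -[RHS]e.
rewrite (reindex (@enum_val I predT)) /=; last exact/onW_bij/enum_val_bij.
by apply: eq_bigr => k' _; rewrite ?mxE ?enum_rankK ?enum_valK.
Qed.

Section AlgebraicDependence.
Variables (K : fieldType) (n : nat).
Local Notation A := {mpoly K[n]}.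
Local Notation L := {fraction A}.

Let degle d (a : A) := (msize a <= d.+1)%N.

Let degleM d e a b : degle d a -> degle e b -> degle (d + e) (a * b).
Proof.
rewrite /degle; have [->|a0] := eqVneq a 0; first by rewrite mul0r msize0.
have [->|b0] := eqVneq b 0; first by rewrite mulr0 msize0.
by rewrite msizeM //; move: (msize a) (msize b) => x y; clear; lia.
Qed.

Let degle1 : degle 0 1.
Proof. by rewrite /degle msize1. Qed.

Let degleX d k a : degle d a -> degle (k * d) (a ^+ k).
Proof.
by move=> da; elim: k => [|k IHk]; rewrite ?expr0 ?mul0n // exprS mulSn degleM.
Qed.

Let degle_prod (I : finType) d (F : I -> A) :
  (forall i, degle d (F i)) -> degle (#|I| * d) (\prod_i F i).
Proof.
move=> dF; rewrite -sum_nat_const.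
by elim/big_rec2: _ => // i k a _; apply: degleM.
Qed.

(* There are N^(n+1) monomials with exponents < N in n + 1 fractions, and after clearing
   denominators they lie in a space of polynomials of dimension O(N^n). *)
Lemma algebraic_dependence (ev : {rmorphism A -> L}) (s : L) :
  (forall c, ev c%:MP = c%:MP%:F) ->
  exists2 Q : {poly A}, Q != 0 & (map_poly ev Q).[s] = 0.
Proof.
move=> evC; pose x (i : 'I_n) := ev 'X_i.
pose d := (\max_(i < n) maxn (msize (fnum (x i))) (msize (fden (x i)))
  + maxn (msize (fnum s)) (msize (fden s)))%N.
have da i : degle d (fnum (x i)).
  apply: leqW; apply: leq_trans (leq_addr _ _).
  exact: leq_trans (leq_maxl _ _) (leq_bigmax i).
have db i : degle d (fden (x i)).
  apply: leqW; apply: leq_trans (leq_addr _ _).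
  exact: leq_trans (leq_maxr _ _) (leq_bigmax i).
have das : degle d (fnum s).
  by apply: leqW; apply: leq_trans (leq_maxl _ _) (leq_addl _ _).
have dbs : degle d (fden s).
  by apply: leqW; apply: leq_trans (leq_maxr _ _) (leq_addl _ _).
(* With these choices [B = (n + 1) N d + N] exceeds all degrees that occur, and [N > c ^ n] gives
   [B ^ n < N ^ (n + 1)], so unknowns outnumber equations. *)
pose c := (n.+1 * d).+1; pose N := (c ^ n).+1; pose B := (N * c)%N.
pose I : finType := ({ffun 'I_n -> 'I_N} * 'I_N)%type.
pose J : finType := {ffun 'I_n -> 'I_B}.
(* This is the monomial with exponents [e] in the fractions [x i] and [s], multiplied by the common
   denominator [beta] introduced below. *)
pose u (e : I) : A :=
  (\prod_i (fnum (x i) ^+ e.1 i * fden (x i) ^+ (N - e.1 i)))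
  * (fnum s ^+ e.2 * fden s ^+ (N - e.2)).
have deg_u e : degle (n * (N * d) + N * d) (u e).
  have dN a b k : (k <= N)%N -> degle d a -> degle d b ->
      degle (N * d) (a ^+ k * b ^+ (N - k)).
    move=> kN d1 d2; rewrite -[N in (N * d)%N](subnKC kN) mulnDl.
    by apply: degleM; apply: degleX.
  have le (k : 'I_N) : (k <= N)%N by apply/ltnW/ltn_ord.
  apply: degleM; last exact: dN.
  rewrite -[n in (n * _)%N]card_ord; apply: degle_prod => i; exact: dN.
have cardJI : (#|J| < #|I|)%N.
  rewrite /I /J card_prod !card_ffun !card_ord /B expnMn ltn_mul2l.
  by rewrite expn_gt0 /= /N ltnSn.
pose mon (j : J) : 'X_{1..n} := [multinom (j i : nat) | i < n].
have [k [e0 ke0] ku] := linear_dependence (fun e j => (u e)@_(mon j)) cardJI.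
have sum_u : \sum_e k e *: u e = 0.
  apply/mpolyP => m; rewrite mcoeff0 raddf_sum /=.
  have [mB|] := boolP [forall i, (m i < B)%N].
    pose j : J := [ffun i => Ordinal (forallP mB i)].
    have -> : m = mon j by apply/mnmP => i; rewrite mnmE ffunE.
    by rewrite -[RHS](ku j); apply: eq_bigr => e _; rewrite mcoeffZ.
  case/forallPn => i; rewrite -leqNgt => mi.
  apply: big1 => e _; rewrite mcoeffZ (_ : (u e)@_m = 0) ?mulr0 //.
  apply/memN_msupp_eq0/msize_mdeg_ge/(leq_trans (deg_u e)).
  rewrite mdegE (bigD1 i) //=; apply: leq_trans (leq_trans _ mi) (leq_addr _ _).
  have -> : B = (n * (N * d) + N * d + N)%N by rewrite /B /c; ring.
  by rewrite -[X in (X <= _)%N]addn1 leq_add2l.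
pose X (e : I) : A := 'X_[[multinom (e.1 i : nat) | i < n]].
exists (\sum_e (k e *: X e)%:P * 'X^(e.2)).
  (* Distinct exponents [e] give distinct monomials of [Q], so [k e0] is one of its coefficients. *)
  pose m0 := [multinom (e0.1 i : nat) | i < n].
  apply: contra_neq ke0 => /(congr1 (fun Q : {poly A} => Q`_(e0.2)@_m0)).
  rewrite coef0 mcoeff0 coef_sum raddf_sum (bigD1 e0) //= big1 ?addr0.
    by rewrite coefCM coefXn eqxx mulr1 mcoeffZ mcoeffX eqxx mulr1.
  move=> e ne; rewrite coefCM coefXn; have [e2|_] := eqVneq (e0.2 : nat) e.2; last first.
    by rewrite mulr0 mcoeff0.
  rewrite mulr1 mcoeffZ mcoeffX; case: eqP => [e1|_]; last by rewrite mulr0.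
  case/eqP: ne; apply/eqP; rewrite -pair_eqE /pair_eq /= -(inj_eq val_inj) /= e2 eqxx andbT.
  apply/eqP/ffunP => i; apply: val_inj; have /mnmP/(_ i) := e1.
  by rewrite !mnmE.
pose beta : A := \prod_i fden (x i) ^+ N * fden s ^+ N.
have beta0 : beta != 0.
  rewrite mulf_neq0 ?expf_neq0 ?fden_neq0 //.
  by apply/prodf_neq0 => i _; rewrite expf_neq0 ?fden_neq0.
have clear_den (y : L) k' : (k' <= N)%N ->
    y ^+ k' * (fden y)%:F ^+ N = (fnum y)%:F ^+ k' * (fden y)%:F ^+ (N - k').
  move=> kN; rewrite -[in LHS](subnKC kN) exprD mulrA -exprMn.
  have -> : y * (fden y)%:F = (fnum y)%:F.
    by rewrite {1}(fnum_fden y) mulfVK // tofrac_neq0 ?fden_neq0.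
  by [].
have evu e : ev (X e) * s ^+ e.2 * beta%:F = (u e)%:F.
  rewrite /X mpolyXE_id rmorph_prod /beta /u !rmorphM !rmorph_prod mulrACA.
  congr (_ * _); last by rewrite !rmorphXn; apply: clear_den; apply/ltnW/ltn_ord.
  rewrite -big_split; apply: eq_bigr => i _.
  rewrite mnmE !rmorphM !rmorphXn -/(x i).
  by apply: clear_den; apply/ltnW/ltn_ord.
have := congr1 (fun a => a%:F) sum_u; rewrite rmorph_sum rmorph0 /= => sum0.
apply: (mulIf (tofrac_neq0 beta0)); rewrite mul0r -[RHS]sum0.
rewrite rmorph_sum horner_sum mulr_suml; apply: eq_bigr => e _.
rewrite rmorphM /= map_polyC map_polyXn /= hornerM hornerC hornerXn -mulrA.
by rewrite -!mul_mpolyC (rmorphM ev) [in RHS]tofracM -evu evC !mulrA.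
Qed.

End AlgebraicDependence.

Lemma derivation_horner (L : comNzRingType) (D : L -> L) (Q : {poly L}) (s : L) :
  derivation D -> (forall i, D Q`_i = 0) -> D Q.[s] = Q^`().[s] * D s.
Proof.
move=> DP; elim/poly_ind: Q => [|Q c IHQ] DQ.
  by rewrite deriv0 !horner0 (derivation0 DP) mul0r.
have DQ' i : D Q`_i = 0 by have := DQ i.+1; rewrite coefD coefMX coefC addr0.
have Dc : D c = 0 by have := DQ 0%N; rewrite coefD coefMX coefC add0r.
rewrite hornerMXaddC derivMXaddC hornerD hornerMX (derivationD DP) (derivationM DP).
by rewrite IHQ // Dc; ring.
Qed.

Lemma derivation_transcendental (L : fieldType) (D : L -> L) (s : L) (Q : {poly L}) :
  (forall n, n.+1%:R != 0 :> L) -> derivation D -> D s != 0 ->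
  (forall i, D Q`_i = 0) -> Q.[s] = 0 -> Q = 0.
Proof.
move=> char0 DP Ds; have [n] := ubnP (size Q).
elim: n => // n IHn in Q *; rewrite ltnS => Qn DQ Qs.
have Q's : Q^`().[s] = 0.
  have := derivation_horner s DP DQ; rewrite Qs (derivation0 DP) => /esym/eqP.
  by rewrite mulf_eq0 (negPf Ds) orbF => /eqP.
have [//|Q0] := eqVneq Q 0.
have Q'0 : Q^`() = 0.
  apply: IHn => // [|i]; first exact: leq_trans (lt_size_deriv Q0) Qn.
  by rewrite coef_deriv -mulr_natr (derivationM DP) DQ (derivation_nat DP) mul0r mulr0 addr0.
have Qc : Q = (Q`_0)%:P.
  apply/polyP => -[|i]; rewrite coefC //=; have := congr1 (fun P : {poly L} => P`_i) Q'0.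
  by rewrite coef_deriv coef0 -mulr_natr => /eqP; rewrite mulf_eq0 (negPf (char0 i)) orbF => /eqP.
by rewrite Qc; move: Qs; rewrite {1}Qc hornerC => ->.
Qed.

(** * Reduction to one variable and conclusion *)

(** Reduces identities about ring morphisms and derivations to constants and variables. *)
Lemma mpoly_generated_ind (n : nat) (K : fieldType) (P : {mpoly K[n]} -> Prop) :
  (forall c, P c%:MP) -> (forall i, P 'X_i) ->
  (forall a b, P a -> P b -> P (a + b)) -> (forall a b, P a -> P b -> P (a * b)) ->
  forall a, P a.
Proof.
move=> PC PX PD PM; elim/mpolyind => [|c m a _ _ Pa]; first by rewrite -mpolyC0; apply: (PC).
apply: PD => //; rewrite -mul_mpolyC; apply: (PM) => //; rewrite mpolyXE_id.
elim/big_ind: _ => [|x y|i _]; [by rewrite -mpolyC1; apply: (PC)|exact: (PM)|].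
elim: (m i) => [|k IHk]; first by rewrite expr0 -mpolyC1; apply: (PC).
by rewrite exprS; apply: (PM).
Qed.

Lemma mderiv_derivation (n : nat) (K : fieldType) (j : 'I_n) :
  derivation (@mderiv n K j).
Proof. by split=> a b; rewrite ?mderivD ?mderivM. Qed.

Lemma mderivXU (n : nat) (K : fieldType) (i j : 'I_n) :
  mderiv j 'X_i = (i == j)%:R :> {mpoly K[n]}.
Proof.
rewrite mderivX mnm1E; case: eqP => [->|_]; last by rewrite scale0r.
by rewrite scale1r -[X in (X - _)%MM]add0m addmK mpolyX0.
Qed.

Lemma derivation_mderiv_comm (n : nat) (K : fieldType) (S : comNzRingType)
    (h : {rmorphism {mpoly K[n]} -> S}) (e : S -> S) (j : 'I_n) :
  derivation e -> (forall c, e (h c%:MP) = 0) -> (forall i, e (h 'X_i) = (i == j)%:R) ->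
  forall a, e (h a) = h (mderiv j a).
Proof.
move=> eP eC eX; elim/mpoly_generated_ind => [c|i|a b ea eb|a b ea eb].
- by rewrite eC mderivC rmorph0.
- by rewrite eX mderivXU rmorph_nat.
- by rewrite mderivD !rmorphD (derivationD eP) ea eb.
- by rewrite mderivM rmorphD !rmorphM (derivationM eP) ea eb.
Qed.

Lemma map_derivationC (F : fieldType) (D : F -> F) (c : F) :
  derivation D -> map_poly D c%:P = (D c)%:P.
Proof.
move=> DP; have D0 := derivation0 DP; apply/polyP => i.
by rewrite coef_map_id0 // !coefC; case: eqP.
Qed.

Lemma map_derivation_line (F : fieldType) (D : F -> F) (c : F) (k : nat) :
  derivation D -> map_poly D (c%:P + k%:R * 'X) = (D c)%:P.
Proof.
move=> DP; have D0 := derivation0 DP; have mP := map_poly_derivation DP.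
rewrite (derivationD mP) (derivationM mP) (derivation_nat mP) map_derivationC //.
have -> : map_poly D 'X = 0; last by rewrite mul0r mulr0 !addr0.
by apply/polyP => i; rewrite coef_map_id0 // coefX coef0; apply: derivation_nat.
Qed.

Lemma jacobian_rmorph (E F : comNzRingType) (h : {rmorphism E -> F})
    (d1 d2 d3 : E -> E) (e1 e2 e3 : F -> F) (x y z : E) :
  (forall a, e1 (h a) = h (d1 a)) -> (forall a, e2 (h a) = h (d2 a)) ->
  (forall a, e3 (h a) = h (d3 a)) ->
  jacobian e1 e2 e3 (h x) (h y) (h z) = h (jacobian d1 d2 d3 x y z).
Proof.
by move=> h1 h2 h3; rewrite /jacobian !h1 !h2 !h3 !(rmorphD, rmorphN, rmorphM).
Qed.

Lemma branch_square_rmorph (E F : comNzRingType) (h : {rmorphism E -> F}) (p q u w : E) :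
  w ^+ 2 = branch p q u -> h w ^+ 2 = branch (h p) (h q) (h u).
Proof.
by move=> /(congr1 h); rewrite /branch !(rmorphM, rmorphB, rmorphXn, rmorph_nat).
Qed.

Lemma frac_deriv_morph (R S : idomainType) (g : {rmorphism R -> S})
    (g_inj : forall a, (@tofrac S \o g) a = 0 -> a = 0) (d : R -> R) (e : S -> S) f :
  derivation d -> derivation e -> (forall a, e (g a) = g (d a)) ->
  frac_deriv e (frac_morph g_inj f) = frac_morph g_inj (frac_deriv d f).
Proof.
move=> dP eP eg; have b0 := fden_neq0 f.
have gb0 : g (fden f) != 0.
  by apply: contra_neq b0 => gb0; apply: g_inj; rewrite /= gb0 tofrac0.
rewrite {1}(fnum_fden f) frac_morph_div //= frac_deriv_div // !eg.
rewrite /frac_deriv frac_morph_div ?expf_neq0 //=.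
by rewrite (rmorphXn g) (rmorphB g) !(rmorphM g).
Qed.

(** * Restriction to lines through the generic point *)

Section GenericLine.
Variables (n : nat) (K : fieldType).
Local Notation A := {mpoly K[n]}.
Local Notation L := {fraction A}.
Local Notation pd j := (frac_deriv (@mderiv n K j)).

(* line_poly i a is a(s + t e_i), the restriction of a to the line through the generic
   point s in the direction e_i. *)
Definition line_point (i k : 'I_n) : {poly L} := ('X_k)%:F%:P + (k == i)%:R * 'X.

Definition line_poly (i : 'I_n) : A -> {poly L} :=
  mmap (polyC \o (@tofrac A \o @mpolyC n K)) (line_point i).

HB.instance Definition _ i := GRing.RMorphism.copy (line_poly i)
  (mmap (polyC \o (@tofrac A \o @mpolyC n K)) (line_point i)).

Lemma line_polyC i c : line_poly i c%:MP = (c%:MP%:F)%:P.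
Proof. by rewrite /line_poly mmapC. Qed.

Lemma line_polyX i k : line_poly i 'X_k = line_point i k.
Proof. by rewrite /line_poly mmapX mmap1U. Qed.

Lemma line_poly_at0 i a : (line_poly i a).[0] = a%:F.
Proof.
elim/mpoly_generated_ind: a => [c|k|a b ea eb|a b ea eb].
- by rewrite line_polyC hornerC.
- by rewrite line_polyX /line_point hornerD hornerM hornerX mulr0 addr0 hornerC.
- by rewrite (rmorphD (line_poly i)) hornerD (rmorphD (@tofrac _)); congr (_ + _).
- by rewrite (rmorphM (line_poly i)) hornerM (rmorphM (@tofrac _)); congr (_ * _).
Qed.

Lemma line_poly_deriv i a : (line_poly i a)^`() = line_poly i (mderiv i a).
Proof.
apply: derivation_mderiv_comm => [|c|k]; first exact: deriv_derivation.
  by rewrite /= line_polyC derivC.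
rewrite /= line_polyX /line_point derivD derivC add0r -polyC_natr mul_polyC derivZ derivX.
by rewrite -mul_polyC polyC_natr mulr1.
Qed.

(** The coefficients of the line depend on the generic point, so differentiating them moves that
    point while the parameter stays fixed. *)
Lemma line_poly_map_deriv i j a :
  map_poly (pd j) (line_poly i a) = line_poly i (mderiv j a).
Proof.
have dP := frac_deriv_derivation (@mderiv_derivation n K j).
apply: derivation_mderiv_comm => [|c|k]; first exact: map_poly_derivation.
  rewrite /= line_polyC (map_derivationC _ dP).
  by rewrite (frac_deriv_tofrac (mderiv_derivation _ _)) mderivC tofrac0 polyC0.
rewrite /= line_polyX (map_derivation_line _ _ dP).
by rewrite (frac_deriv_tofrac (mderiv_derivation _ _)) mderivXU rmorph_nat polyC_natr.
Qed.

Fact line_frac_inj i a : (@tofrac {poly L} \o line_poly i) a = 0 -> a = 0.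
Proof.
move=> /= /eqP; rewrite tofrac_eq0 => /eqP a0; apply/eqP.
by rewrite -tofrac_eq0 -(line_poly_at0 i) a0 horner0.
Qed.

Definition line_frac i : {rmorphism L -> {fraction {poly L}}} :=
  frac_morph (@line_frac_inj i).

Hypothesis K_char0 : forall m, m.+1%:R != 0 :> K.

Lemma mpoly_frac_char0 m : m.+1%:R != 0 :> L.
Proof.
have -> : m.+1%:R = ((m.+1%:R : K)%:MP : A)%:F by rewrite mpolyC_nat tofracMn tofrac1.
by rewrite tofrac_eq0 mpolyC_eq0.
Qed.

(** On the line in direction [i], the derivative in the parameter corresponds to the partial
    derivative [pd i], and the coefficientwise [pd j], [pd k] to themselves. The Jacobian thus maps
    to one that vanishes over K(t), and the restriction is injective. *)
Lemma branch_square_jacobian_mpoly i j k (p q u w : L) :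
  w ^+ 2 = branch p q u -> jacobian (pd i) (pd j) (pd k) p q u = 0.
Proof.
move=> wS; have dP l := frac_deriv_derivation (@mderiv_derivation n K l).
have := branch_square_jacobian mpoly_frac_char0 (dP j) (dP k)
  (branch_square_rmorph (line_frac i) wS).
rewrite (jacobian_rmorph (d1 := pd i) (d2 := pd j) (d3 := pd k)) => [|a|a|a].
- by move/eqP; rewrite fmorph_eq0 => /eqP.
- apply: frac_deriv_morph; [exact: mderiv_derivation|exact: deriv_derivation|].
  exact: line_poly_deriv.
- apply: frac_deriv_morph; [exact: mderiv_derivation|exact: map_poly_derivation|].
  exact: line_poly_map_deriv.
- apply: frac_deriv_morph; [exact: mderiv_derivation|exact: map_poly_derivation|].
  exact: line_poly_map_deriv.
Qed.

End GenericLine.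

(** * A nonzero derivation killing the image, and the contradiction *)

Lemma derivation_linear_comb (R : comNzRingType) (I : finType) (c : I -> R)
    (d : I -> R -> R) :
  (forall i, derivation (d i)) -> derivation (fun x => \sum_i c i * d i x).
Proof.
move=> dP; split=> x y.
  by rewrite -big_split; apply: eq_bigr => i _; rewrite (derivationD (dP i)) mulrDr.
rewrite mulr_suml mulr_sumr -big_split; apply: eq_bigr => i _.
by rewrite (derivationM (dP i)) /=; ring.
Qed.

Lemma det3_jacobian (R : comNzRingType) (d : 'I_3 -> R -> R) (f : 'I_3 -> R) :
  \det (\matrix_(i, j) d i (f j))
  = jacobian (d 0) (d 1) (d 2) (f 0) (f 1) (f 2).
Proof.
rewrite (expand_det_col _ 0) !big_ord_recl big_ord0 /cofactor.
rewrite !(expand_det_col _ 0) !big_ord_recl !big_ord0 /cofactor !det_mx11 !mxE /=.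
(* Indexing by natural numbers identifies equal ordinals built in different ways, so that [ring]
   sees the same atoms. *)
pose d' k := d (inord k); pose f' k := f (inord k).
have dE i : d i = d' (val i) by rewrite /d' inord_val.
have fE i : f i = f' (val i) by rewrite /f' inord_val.
by rewrite /jacobian !dE !fE /= /bump /=; ring.
Qed.

(** Expanding the 4x4 determinant of derivatives along the column of [z] leaves 3x3 Jacobians of
    [p, q, u] as minors, so the matrix is singular. The extra column makes the combination kill [z],
    from which [x, y, t] are recovered by means of [p, q, u]. *)
Lemma common_kernel (F : fieldType) (d : 'I_4 -> F -> F) (p q u z : F) :
  (forall i j k, jacobian (d i) (d j) (d k) p q u = 0) ->
  exists2 c : 'I_4 -> F, exists i, c i != 0 &
    [/\ \sum_i c i * d i p = 0, \sum_i c i * d i q = 0,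
        \sum_i c i * d i u = 0 & \sum_i c i * d i z = 0].
Proof.
move=> J0; pose f (j : 'I_4) := nth 0 [:: p; q; u; z] j.
pose M : 'M[F]_4 := \matrix_(i, j) d i (f j).
have : \det M == 0.
  rewrite (expand_det_col _ 3); apply/eqP/big1 => i _.
  rewrite /cofactor.
  have -> : row' i (col' 3 M) = \matrix_(a, b) d (lift i a) (f (lift 3 b)).
    by apply/matrixP => a b; rewrite !mxE.
  by rewrite (det3_jacobian (fun a => d (lift i a)) (fun b => f (lift 3 b))) J0 !mulr0.
case/det0P => c c0 cM; have [k ck] : exists k, c 0 k != 0.
  apply/existsP; apply: contraNT c0 => /existsPn c0; apply/eqP/rowP => k.
  by rewrite mxE; apply/eqP/negPn.
have sum0 j : \sum_i c 0 i * d i (f j) = 0.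
  have /matrixP/(_ 0 j) := cM; rewrite !mxE => e; rewrite -[RHS]e.
  by apply: eq_bigr => i _; rewrite mxE.
exists (c 0); first by exists k.
split; [exact: (sum0 0)|exact: (sum0 1)|exact: (sum0 2)|exact: (sum0 3)].
Qed.

(** Under the substitution, [branch] is [f1 f2 f3 f4] times the square of
    [z ^+ 2 / (x * y) ^+ 3]. *)
Lemma branch_square (F : fieldType) (x y z t h : F) : x != 0 -> y != 0 -> z != 0 ->
  (4 * x - z) * (4 * y - z) * (4 * x ^+ 2 * y - z * (y - t) ^+ 2)
    * (4 * x * y ^+ 2 - z * (x - t) ^+ 2) = h ^+ 2 ->
  (z ^+ 2 * h / (x * y) ^+ 3) ^+ 2 = branch (z / x) (z / y) (z * t / (x * y)).
Proof.
move=> x0 y0 z0 e.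
have -> : (z ^+ 2 * h / (x * y) ^+ 3) ^+ 2 = z ^+ 4 * h ^+ 2 / (x * y) ^+ 6.
  by field; rewrite x0 y0.
by rewrite -e /branch; field; rewrite x0 y0.
Qed.

(** [D] kills the image of [ev], and every [s] is a root of a nonzero polynomial with coefficients
    in that image; a derivation in characteristic 0 kills such elements. *)
Lemma algebraic_kernel (K : fieldType) (n : nat)
    (ev : {rmorphism {mpoly K[n]} -> {fraction {mpoly K[n]}}})
    (D : {fraction {mpoly K[n]}} -> {fraction {mpoly K[n]}}) :
  (forall m, m.+1%:R != 0 :> K) -> (forall c, ev c%:MP = c%:MP%:F) ->
  (forall a, ev a = 0 -> a = 0) ->
  derivation D -> (forall c, D c%:MP%:F = 0) -> (forall i, D (ev 'X_i) = 0) ->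
  forall s, D s = 0.
Proof.
move=> K0 evC ev_inj DP DC DX s; apply/eqP/negPn/negP => Ds.
have Dev a : D (ev a) = 0.
  elim/mpoly_generated_ind: a => [c|i|a b ea eb|a b ea eb].
  - by rewrite evC DC.
  - exact: DX.
  - by rewrite (rmorphD ev) (derivationD DP) ea eb addr0.
  - by rewrite (rmorphM ev) (derivationM DP) ea eb mul0r mulr0 addr0.
have [Q Q0 Qs] := algebraic_dependence s evC.
have := derivation_transcendental (mpoly_frac_char0 n K0) DP Ds _ Qs.
have DQ i : D (map_poly ev Q)`_i = 0 by rewrite coef_map; exact: Dev.
move=> /(_ DQ) evQ0; case/eqP: Q0; apply/polyP => i; rewrite coef0; apply: ev_inj.
by rewrite -coef_map evQ0 coef0.
Qed.

Lemma rmorph_f1234 (K : fieldType) (S : comNzRingType) (h : {rmorphism {mpoly K[4]} -> S}) :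
  let x := h 'X_(Ordinal (isT : (0 < 4)%N)) in let y := h 'X_(Ordinal (isT : (1 < 4)%N)) in
  let z := h 'X_(Ordinal (isT : (2 < 4)%N)) in let t := h 'X_(Ordinal (isT : (3 < 4)%N)) in
  h (f1 K * f2 K * f3 K * f4 K)
  = (4 * x - z) * (4 * y - z) * (4 * x ^+ 2 * y - z * (y - t) ^+ 2)
    * (4 * x * y ^+ 2 - z * (x - t) ^+ 2).
Proof.
by move=> x y z t; rewrite /f1 /f2 /f3 /f4 !(rmorphM, rmorphB, rmorphXn, rmorph_nat).
Qed.

Lemma derivation_quotient (F : fieldType) (D : F -> F) (a b c : F) : derivation D ->
  a != 0 -> a * b = c -> D a = 0 -> D c = 0 -> D b = 0.
Proof.
move=> DP a0 e Da Dc; have := derivationM DP a b.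
by rewrite e Da Dc mul0r add0r => /esym/eqP; rewrite mulf_eq0 (negPf a0) => /eqP.
Qed.

Lemma derivation_cross_ratios (F : fieldType) (D : F -> F) (x y z t : F) : derivation D ->
  x != 0 -> y != 0 -> z != 0 ->
  D (z / x) = 0 -> D (z / y) = 0 -> D (z * t / (x * y)) = 0 -> D z = 0 ->
  [/\ D x = 0, D y = 0 & D t = 0].
Proof.
move=> DP x0 y0 z0 Dp Dq Du Dz.
have Dx : D x = 0.
  by apply: (derivation_quotient DP _ _ Dp Dz); rewrite ?divfK // mulf_neq0 ?invr_neq0.
have Dy : D y = 0.
  by apply: (derivation_quotient DP _ _ Dq Dz); rewrite ?divfK // mulf_neq0 ?invr_neq0.
split=> //; apply: (derivation_quotient DP z0 erefl Dz).
have <- : z * t / (x * y) * (x * y) = z * t by rewrite divfK ?mulf_neq0.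
by rewrite (derivationM DP) Du (derivationM DP) Dx Dy; ring.
Qed.

Section NotRationalizable.
Variable K : fieldType.
Hypothesis K_char0 : forall m, m.+1%:R != 0 :> K.
Local Notation A := {mpoly K[4]}.
Local Notation L := {fraction A}.
Local Notation pd j := (frac_deriv (@mderiv 4 K j)).

Lemma f1234_not_rationalizable : ~ rationalizable (f1 K * f2 K * f3 K * f4 K).
Proof.
case=> phi phiC [h phih].
pose ev : {rmorphism A -> L} := phi \o @tofrac A.
have evC c : ev c%:MP = c%:MP%:F := phiC c.
have ev_inj a : ev a = 0 -> a = 0.
  by move/eqP; rewrite /= fmorph_eq0 tofrac_eq0 => /eqP.
have X0 i : ev 'X_i != 0.
  apply/eqP => /ev_inj Xi0; have := congr1 (mcoeff U_(i)) Xi0.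
  by rewrite mcoeffX eqxx mcoeff0 => /eqP; rewrite oner_eq0.
have := rmorph_f1234 ev; set x := ev 'X__; set y := ev 'X__; set z := ev 'X__; set t := ev 'X__.
move=> /= evf; have {phih evf} e := etrans (esym evf) phih.
have x0 : x != 0 := X0 _; have y0 : y != 0 := X0 _.
have z0 : z != 0 := X0 _.
have J0 i j k := branch_square_jacobian_mpoly K_char0 i j k (branch_square x0 y0 z0 e).
have [c [i ci] [Dp Dq Du Dz]] := common_kernel z J0.
have dP j := frac_deriv_derivation (@mderiv_derivation 4 K j).
pose D (a : L) := \sum_j c j * pd j a.
have DP : derivation D := derivation_linear_comb c dP.
(* [D] kills the images of the variables, hence everything; but its value at the variable ['X_i] is
   the nonzero [c i]. *)
case/eqP: ci; suff <- : D ('X_i : A)%:F = c i.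
  apply: (algebraic_kernel K_char0 evC ev_inj DP) => [a|k].
    rewrite /D big1 // => j _.
    by rewrite (frac_deriv_tofrac (mderiv_derivation _ _)) mderivC tofrac0 mulr0.
  have [Dx Dy Dt] := derivation_cross_ratios DP x0 y0 z0 Dp Dq Du Dz.
  case: k => [[|[|[|[|//]]]] lk]; rewrite (bool_irrelevance lk isT);
    [exact: Dx | exact: Dy | exact: Dz | exact: Dt].
rewrite /D (bigD1 i) //= big1 => [|j ji].
  by rewrite (frac_deriv_tofrac (mderiv_derivation _ _)) mderivXU eqxx tofrac1 mulr1 addr0.
rewrite (frac_deriv_tofrac (mderiv_derivation _ _)) mderivXU eq_sym (negPf ji) tofrac0.
by rewrite mulr0.
Qed.

End NotRationalizable.

Lemma rmorph_mul4_sqr (R S : comNzRingType) (h : {rmorphism R -> S}) (a b c d : R)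
    (ha hb hc hd : S) :
  h a = ha ^+ 2 -> h b = hb ^+ 2 -> h c = hc ^+ 2 -> h d = hd ^+ 2 ->
  h (a * b * c * d) = (ha * hb * hc * hd) ^+ 2.
Proof. by move=> ea eb ec ed; rewrite !rmorphM ea eb ec ed !exprMn. Qed.

Lemma rationalizable_set_mul4 (K : fieldType) (n : nat) (a b c d : {mpoly K[n]}) s :
  rationalizable_set [:: a, b, c, d & s] -> rationalizable (a * b * c * d).
Proof.
case=> phi phiC sq; exists phi => //.
have [ha ea] := sq a (mem_nth 0 (isT : (0 < size [:: a, b, c, d & s])%N)).
have [hb eb] := sq b (mem_nth 0 (isT : (1 < size [:: a, b, c, d & s])%N)).
have [hc ec] := sq c (mem_nth 0 (isT : (2 < size [:: a, b, c, d & s])%N)).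
have [hd ed] := sq d (mem_nth 0 (isT : (3 < size [:: a, b, c, d & s])%N)).
exists (ha * hb * hc * hd).
exact: (rmorph_mul4_sqr (h := phi \o @tofrac {mpoly K[n]}) ea eb ec ed).
Qed.

Theorem theorem1p3 (R : realType) :
  ~ rationalizable (f1 R[i] * f2 R[i] * f3 R[i] * f4 R[i])
  /\ ~ rationalizable_set
         [:: f1 R[i]; f2 R[i]; f3 R[i]; f4 R[i]; f5 R[i]; f6 R[i]].
Proof.
(* Characteristic 0 is read off from the partial order of [R[i]], in which [m + 1] is positive. *)
have nrat := @f1234_not_rationalizable R[i] (fun m => lt0r_neq0 (ltr0Sn _ m)).
by split=> // /rationalizable_set_mul4.
Qed.
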